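(* Consider a charged three-body system with masses $m_1,m_2,m_3>0$ and coefficients $\gamma_{12},\gamma_{13},\gamma_{23}\in\mathbb{R}$. Depending on the values of the masses $m_i$ and of the parameters $\gamma_{ij}$ there are, up to similarity transformations, zero, one, two or three critical points associated to collinear central configurations (that is, the number is always one of $0,1,2,3$, and each of these values occurs for suitable parameters). Up to similarity transformations there is at most one critical point associated to non-collinear central configurations.
   Context: Configuration space: $\mathcal X=\{q=(q_1,q_2,q_3)\in(\mathbb{R}^3)^3 : q_i\neq q_j \text{ for } i\ne j\}$; phase space $M=T^*\mathcal X\simeq \mathcal X\times\mathbb{R}^{9}$ with coordinates $(q,p)$ and standard symplectic form. The charged three-body system has Hamiltonian $H(q,p)=\sum_i\frac{1}{2m_i}\|p_i\|^2+V(q)$ with $V(q)=-\sum_{i<j}\gamma_{ij}/\|q_i-q_j\|$. Let $m=\sum_i m_i$, $Q=\frac1m\sum_i m_iq_i$ (center of mass), $P=\sum_i p_i$, $L=\sum_i q_i\times p_i$. The integral map is $\mathcal F=(H,L,P,Q):M\to\mathbb{R}^{10}$; a critical point is a point where $D\mathcal F$ has rank less than $10$. Critical points are considered at $P=0$, $Q=0$. A central configuration is $q\in\mathcal X$ for which there is a multiplier $\lambda\in\mathbb{R}$ with $\frac{\partial V}{\partial q_i}=\lambda m_i(q_i-Q)$ for all $i$. It is collinear if all $q_i$ lie on one line, otherwise non-collinear. (Every configuration of three bodies is planar.) A central configuration $q$ with $Q=0$ and positive multiplier $\lambda$ yields critical points $(q,p)$ with $p_i=m_i\,e\times q_i$,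 where $e\in\mathbb{R}^3$ satisfies $\langle e,q_i\rangle=0$ for all $i$ and $\langle e,e\rangle=\lambda$; these are the critical points associated to the central configuration. Counting them up to similarity means counting the central configurations $q$ with positive multiplier up to translations, rotations (elements of $SO(3)$) and dilations. *)

(* Defs.v *)
From HB Require Import structures.
From mathcomp Require Import all_boot all_order all_algebra.
From mathcomp Require Import all_classical all_reals all_analysis.

Set Implicit Arguments.
Unset Strict Implicit.
Unset Printing Implicit Defensive.

Import Order.TTheory GRing.Theory Num.Theory.
Import numFieldNormedType.Exports.

Local Open Scope classical_set_scope.
Local Open Scope ring_scope.

(* A triple of vectors of R^3 is a 3 x 3 matrix whose row i belongs to body i. *)

Definition phase (R : realType) := ('M[R]_3 * 'M[R]_3)%type.

Definition dot (R : realType) (u v : 'rV[R]_3) : R := (u *m v^T) 0 0.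

(* The library norm `|u| on row vectors is the sup norm. *)
Definition enorm (R : realType) (u : 'rV[R]_3) : R := Num.sqrt (dot u u).

(* Indices k + 1 and k + 2 are computed modulo 3 in 'I_3. *)
Definition cross (R : realType) (u v : 'rV[R]_3) : 'rV[R]_3 :=
  \row_(k < 3) (u 0 (k + 1) * v 0 (k + 2) - u 0 (k + 2) * v 0 (k + 1)).

Definition configuration (R : realType) : set 'M[R]_3 :=
  [set q | forall i j : 'I_3, i != j -> row i q != row j q].

(* Only the entries g i j with i < j are used. *)
Definition potential (R : realType) (g : 'I_3 -> 'I_3 -> R) (q : 'M[R]_3) : R :=
  - \sum_(i < 3) \sum_(j < 3 | (i < j)%N) g i j / enorm (row i q - row j q).

Definition hamiltonian (R : realType) (m : 'I_3 -> R) (g : 'I_3 -> 'I_3 -> R)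
    (z : phase R) : R :=
  \sum_(i < 3) (2 * m i)^-1 * enorm (row i z.2) ^+ 2 + potential g z.1.

Definition center_of_mass (R : realType) (m : 'I_3 -> R) (q : 'M[R]_3) :
    'rV[R]_3 :=
  (\sum_(i < 3) m i)^-1 *: \sum_(i < 3) m i *: row i q.

Definition total_momentum (R : realType) (p : 'M[R]_3) : 'rV[R]_3 :=
  \sum_(i < 3) row i p.

Definition angular_momentum (R : realType) (z : phase R) : 'rV[R]_3 :=
  \sum_(i < 3) cross (row i z.1) (row i z.2).

Definition integral_map (R : realType) (m : 'I_3 -> R) (g : 'I_3 -> 'I_3 -> R)
    (z : phase R) : R^o * 'rV[R]_3 * 'rV[R]_3 * 'rV[R]_3 :=
  (hamiltonian m g z, angular_momentum z, total_momentum z.2,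
   center_of_mass m z.1).

(* The rank of the differential is the dimension of its image. *)
Definition critical_point (R : realType) (m : 'I_3 -> R)
    (g : 'I_3 -> 'I_3 -> R) : set (phase R) :=
  [set z | configuration z.1 /\
    (\dim (limg (linfun ('d (integral_map m g) z))) < 10)%N].

(* 'D_(delta_mx i k) is the partial derivative along coordinate k of body i. *)
Definition central_configuration (R : realType) (m : 'I_3 -> R)
    (g : 'I_3 -> 'I_3 -> R) (q : 'M[R]_3) (lambda : R) : Prop :=
  configuration q /\
  forall i k : 'I_3, 'D_(delta_mx i k) (potential g) q =
    lambda * m i * (row i q - center_of_mass m q) 0 k.

Definition collinear (R : realType) (q : 'M[R]_3) : Prop :=
  exists a d : 'rV[R]_3, d != 0 /\
    forall i : 'I_3, exists t : R, row i q = a + t *: d.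

(* Critical points of the integral map, at P = 0 and Q = 0, that are associated
   to the central configuration z.1 with positive multiplier. *)
Definition associated_critical_point (R : realType) (m : 'I_3 -> R)
    (g : 'I_3 -> 'I_3 -> R) : set (phase R) :=
  [set z | [/\ critical_point m g z,
    total_momentum z.2 = 0,
    center_of_mass m z.1 = 0 &
    exists (lambda : R) (e : 'rV[R]_3),
      [/\ 0 < lambda,
          central_configuration m g z.1 lambda,
          forall i, dot e (row i z.1) = 0,
          dot e e = lambda &
          forall i, row i z.2 = m i *: cross e (row i z.1)]]].

Definition collinear_critical_point (R : realType) (m : 'I_3 -> R)
    (g : 'I_3 -> 'I_3 -> R) : set (phase R) :=
  [set z | associated_critical_point m g z /\ collinear z.1].

Definition noncollinear_critical_point (R : realType) (m : 'I_3 -> R)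
    (g : 'I_3 -> 'I_3 -> R) : set (phase R) :=
  [set z | associated_critical_point m g z /\ ~ collinear z.1].

(* Dilation by a, rotation in SO(3) (acting on row vectors), translation by c. *)
Definition similar (R : realType) (q q' : 'M[R]_3) : Prop :=
  exists (a : R) (A : 'M[R]_3) (c : 'rV[R]_3),
    [/\ 0 < a, A *m A^T = 1%:M, \det A = 1 &
        forall i : 'I_3, row i q' = a *: (row i q *m A) + c].

(* Critical points are identified when their underlying central configurations
   are similar: the different choices of e over one configuration count once. *)
Definition similarity_classes (R : realType) (S : set (phase R)) :
    set (set (phase R)) :=
  [set C | exists2 z, S z & C = [set w | S w /\ similar z.1 w.1]].

(* Main.v *)
(* A collinear central configuration is determined up to similarity by its shape
   x = (s1 - s0) / (s2 - s0), where s0, s1, s2 are the positions on the line.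
   For each choice of the middle body the ratio t of the two gaps is a positive
   root of a quintic (Euler's), and the multiplier must be positive.  If p has
   n + 1 positive roots then t p' - k p has n; choosing k among the exponents
   removes a sign change, as in Descartes' rule.  According to the signs of the
   gamma_ij this gives at most 1 + 1 + 1, 3 + 0 + 0, 1 + 2 + 0 or 0 solutions
   for the three middle bodies; when only gamma_ik is negative, the two orders
   having i and k adjacent exclude each other.  A non-collinear central
   configuration satisfies gamma_ij = lambda m_i m_j r_ij^3 / m, so its sides are
   determined up to a common factor, hence so is the triangle up to SO(3). *)

Require Import Defs.
From HB Require Import structures.
From mathcomp Require Import all_boot all_order all_algebra.
From mathcomp Require Import all_classical all_reals all_analysis.
From mathcomp Require Import finmap ring lra.
Import Order.TTheory GRing.Theory Num.Theory.
Import numFieldNormedType.Exports.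
Local Open Scope classical_set_scope.
Local Open Scope ring_scope.

Set Implicit Arguments.
Unset Strict Implicit.
Unset Printing Implicit Defensive.

(** * Positive roots of polynomials *)

Section RootCounting.
Context {R : realType}.
Implicit Types (p : {poly R}) (x y c : R) (k : nat).

(** Two features of the quintic shape the count. It has lost the condition [0 < lambda], and its
    coefficients of degree 2 and 3 may have an undetermined sign even when the signs of all gamma_ij
    are known. Differentiating p(t) / t^k costs one root and deletes the coefficient of degree k, so
    at most two such steps, followed by a positivity argument, suffice in most sign patterns. They
    do not suffice when the two end bodies repel each other and both adjacent pairs attract: the
    coefficients may then have signs - - + - + +, with three changes, although there is only one
    solution. There the equations with [lambda] are used directly. Zero counts as both nonnegative
    and nonpositive. Hence eight weak sign patterns cover all parameters, and an example with
    vanishing coefficients may use the bounds of several patterns at once. On the side of the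
    integral map, the rank drops because one covector, dH - <e, dL>, annihilates the image of the
    differential; the dimension of that image is never computed. *)

Definition twist k p : {poly R} := 'X * p^`() - k%:R *: p.

Lemma coef_twist k p i : (twist k p)`_i = (i%:R - k%:R) * p`_i.
Proof.
rewrite coefB coefZ coefXM coef_deriv.
case: i => [|i] /=; rewrite mulrBl ?mul0r //.
by rewrite [i.+1%:R * _]mulr_natl.
Qed.

(* Up to the unit t^(k+1), [twist k p] is the derivative of p(t) / t^k. *)
Lemma root_twist k p x y : 0 < x -> x < y -> root p x -> root p y ->
  exists c, [/\ x < c, c < y & root (twist k p) c].
Proof.
move=> x0 xy /rootP px /rootP py.
pose f := horner p * (GRing.inv : R -> R) ^+ k.
have fE (t : R) : f t = p.[t] * t^-1 ^+ k by rewrite /f /GRing.mul/= exprfctE.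
pose df (t : R) := p.[t] * (k%:R * t^-1 ^+ k.-1 * - t ^- 2) + t^-1 ^+ k * p^`().[t].
have fd (t : R) : 0 < t -> is_derive t 1 f (df t).
  move=> t0; have tn0 : t != 0 by rewrite gt_eqF.
  have dV : is_derive t 1 (GRing.inv : R -> R) (- t ^- 2).
    apply: DeriveDef; first exact: derivableV.
    by rewrite deriveV// derive_id scaler1.
  apply: (is_derive_eq (is_deriveM (is_derive_poly p t) (is_deriveX k dV))).
  by rewrite exprfctE.
have [|||c /[!in_itv]/= /andP[xc cy] dc] := @Rolle R f x y xy.
- move=> t /[!in_itv]/= /andP[xt _].
  by have [] := fd t (lt_trans x0 xt).
- apply: derivable_within_continuous => t /[!in_itv]/= /andP[xt _].
  by have [] := fd t (lt_le_trans x0 xt).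
- by rewrite !fE px py !mul0r.
exists c; split => //; have c0 : 0 < c := lt_trans x0 xc.
have := @derive_val _ _ _ _ _ _ _ dc.
rewrite (@derive_val _ _ _ _ _ _ _ (fd c c0)) /df => E.
have cn0 : c != 0 by rewrite gt_eqF.
apply/rootP; rewrite /twist !hornerE.
have -> : c * p^`().[c] - k%:R * p.[c] = c ^+ k.+1 * 
   (p.[c] * (k%:R * c^-1 ^+ k.-1 * - c ^- 2) + c^-1 ^+ k * p^`().[c]).
  (* At k = 0 the exponent [k.-1] is truncated to 0, which is harmless since its term carries the
     factor [0%:R]. *)
  case: k {f fE df fd dc E} => [|k] /=; first by rewrite !expr0; ring.
  by rewrite !exprS !exprVn; field; rewrite cn0 expf_neq0.
by rewrite E mulr0.
Qed.

(** Twisting multiplies the coefficient of degree i by i - k, so its kernel consists of the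
    multiples of X^k, and a nonzero monomial has no positive root. *)
Lemma twist_eq0 k p x : 0 < x -> root p x -> twist k p = 0 -> p = 0.
Proof.
move=> x0 /rootP px tp0.
have p0 i : i != k -> p`_i = 0.
  move=> ik; have /eqP := coef_twist k p i.
  rewrite tp0 coef0 eq_sym mulf_eq0 subr_eq0 eqr_nat (negbTE ik) => /eqP.
  by [].
suff pk : p`_k = 0 by apply/polyP => i; rewrite coef0; case: (eqVneq i k) => [->|/p0].
have [kp|kp] := ltnP k (size p); last exact: nth_default.
move: px; rewrite horner_coef (bigD1 (Ordinal kp))//= big1; last first.
  by move=> i ik; rewrite p0 ?mul0r// -val_eqE.
by rewrite addr0 => /eqP; rewrite mulf_eq0 expf_eq0 (gt_eqF x0) andbF orbF => /eqP.
Qed.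

(** After the twist all coefficients are nonnegative, so at a positive root every term vanishes. The
    coefficient of degree k itself is left free: this is how a coefficient of unknown sign is
    absorbed. *)
Lemma one_sign_change k p x y : 0 < x -> x < y -> root p x -> root p y ->
  (forall i, (i < k)%N -> p`_i <= 0) -> (forall i, (k < i)%N -> 0 <= p`_i) ->
  p = 0.
Proof.
move=> x0 xy px py lek gek.
have [c [xc cy /rootP]] := root_twist k x0 xy px py.
have c0 := lt_trans x0 xc.
have tge0 i : 0 <= (twist k p)`_i.
  rewrite coef_twist; have [ik|ik|->] := ltngtP i k; last by rewrite subrr mul0r.
  - by rewrite mulr_le0 ?lek// subr_le0 ler_nat ltnW.
  - by rewrite mulr_ge0 ?gek// subr_ge0 ler_nat ltnW.
rewrite horner_coef => /eqP; rewrite psumr_eq0; last first.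
  by move=> i _; rewrite mulr_ge0// exprn_ge0// ltW.
move=> /allP t0; apply: (@twist_eq0 k p x x0 px); apply/polyP => i; rewrite coef0.
have [ti|ti] := ltnP i (size (twist k p)); last exact: nth_default.
have /= := t0 (Ordinal ti) (mem_index_enum _).
by rewrite mulf_eq0 expf_eq0 (gt_eqF c0) andbF orbF => /eqP.
Qed.

End RootCounting.

(** * Central configurations of three bodies in a given order *)

Section OrderedTriple.
Context {R : realType}.
Implicit Types mi mj mk gij gik gjk t x y : R.

(* Bodies i, j, k at positions 0, 1, 1 + t: the two equations are the differences
   of the accelerations of j and i and of those of k and j. *)
Definition ordered_cc mi mj mk gij gik gjk t : Prop :=
  exists2 lambda : R, 0 < lambda & [/\ 0 < t,
    lambda = gij * (mi^-1 + mj^-1) + gik / (mi * (1 + t) ^+ 2)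
             - gjk / (mj * t ^+ 2) &
    t * lambda = gjk * (mj^-1 + mk^-1) / t ^+ 2 + gik / (mk * (1 + t) ^+ 2)
                 - gij / mj].

(** * Number of gap ratios for one order of the bodies and given signs *)

Section Counting.
Variables mi mj mk gij gik gjk : R.
Hypotheses (mi0 : 0 < mi) (mj0 : 0 < mj) (mk0 : 0 < mk).
(** Weighting each coefficient by the mass of the third body compares it with gravitation: for gij =
    mi mj, and likewise for the other pairs, [al], [be] and [de] coincide and [cc_poly] is a
    multiple of Euler's quintic. *)
Let al := gij * mk.
Let be := gik * mj.
Let de := gjk * mi.
Local Notation sol := (ordered_cc mi mj mk gij gik gjk).

(* Elimination of lambda, cleared of denominators by
   mi * mj * mk * t ^+ 2 * (1 + t) ^+ 2. *)
Definition cc_poly : {poly R} := Poly [::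
  - (de * (mj + mk));
  - (de * (2 * mj + 3 * mk));
  al * mi - be * mi - de * (mj + 3 * mk);
  al * (3 * mi + mj) + (be - de) * mk;
  al * (3 * mi + 2 * mj);
  al * (mi + mj)].

Lemma root_cc_poly t : sol t -> root cc_poly t.
Proof.
move=> [lam lam0 [t0 E1 E2]]; apply/rootP.
have t1 : 1 + t != 0 by rewrite gt_eqF// addr_gt0.
rewrite horner_Poly /=.
(* One copy of [t * lam] is expanded by the second equation, the other by the first; their
   difference with denominators cleared is the quintic. *)
transitivity (mi * mj * mk * t ^+ 2 * (1 + t) ^+ 2 * (t * lam - t * lam)).
  by rewrite {2}E2 E1 /al /be /de; field; rewrite t1 !gt_eqF.
by rewrite subrr mulr0.
Qed.

(** A vanishing quintic forces all three coefficients [gij], [gik], [gjk] to be 0, and then the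
    first equation gives [lambda] = 0. *)
Lemma cc_poly_neq0 t : sol t -> cc_poly != 0.
Proof.
move=> [lam lam0 [t0 E1 _]]; apply/eqP => p0.
have c i : cc_poly`_i = 0 by rewrite p0 coef0.
have := c 0%N; rewrite coef_Poly /= /de => c0.
have := c 5; rewrite coef_Poly /= /al => c5.
have g1 : gij = 0.
  by apply/eqP; move/eqP: c5; rewrite !mulf_eq0 (gt_eqF mk0) (gt_eqF (addr_gt0 mi0 mj0)) !orbF.
have g3 : gjk = 0.
  by apply/eqP; move/eqP: c0; rewrite oppr_eq0 !mulf_eq0 (gt_eqF mi0) (gt_eqF (addr_gt0 mj0 mk0)) !orbF.
have := c 2; rewrite coef_Poly /= /al /be /de g1 g3 !mul0r subr0 sub0r => c2.
have g2 : gik = 0.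
  by apply/eqP; move/eqP: c2; rewrite oppr_eq0 !mulf_eq0 (gt_eqF mi0) (gt_eqF mj0) !orbF.
by move: lam0; rewrite E1 g1 g2 g3 !mul0r subr0 addr0 ltxx.
Qed.

Lemma cc_unique_nonneg x y : 0 <= gij -> 0 <= gik -> 0 <= gjk ->
  sol x -> sol y -> ~ x < y.
Proof.
move=> g1 g2 g3 sx sy xy.
have x0 : 0 < x by case: sx => ? ? [].
have a0 : 0 <= al by rewrite mulr_ge0// ltW.
have b0 : 0 <= be by rewrite mulr_ge0// ltW.
have d0 : 0 <= de by rewrite mulr_ge0// ltW.
have [ai aj bi bk] : [/\ 0 <= al * mi, 0 <= al * mj, 0 <= be * mi & 0 <= be * mk].
  by split; rewrite mulr_ge0// ltW.
have [dj dk] : 0 <= de * mj /\ 0 <= de * mk by split; rewrite mulr_ge0// ltW.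
(* The signs in degrees 2 and 3 are open. If the cubic coefficient is nonnegative, degree 2 is the
   free one. Otherwise [de * mk] exceeds 3 [al * mi], which makes the quadratic coefficient
   nonpositive, and degree 3 is the free one. *)
have [c3|c3] := lerP 0 (al * (3 * mi + mj) + (be - de) * mk).
  move: (cc_poly_neq0 sx); rewrite (@one_sign_change R 2 cc_poly x y) ?eqxx ?root_cc_poly//.
    by case=> [|[|i]] //= _; rewrite coef_Poly /=; lra.
  by case=> [|[|[|[|[|[|i]]]]]] //= _; rewrite coef_Poly /= ?nth_nil//; lra.
move: (cc_poly_neq0 sx); rewrite (@one_sign_change R 3 cc_poly x y) ?eqxx ?root_cc_poly//.
  by case=> [|[|[|i]]] //= _; rewrite coef_Poly /=; lra.
by case=> [|[|[|[|[|[|i]]]]]] //= _; rewrite coef_Poly /= ?nth_nil//; lra.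
Qed.

(* By the first equation lambda increases with t, hence so does t ^+ 3 * lambda,
   as lambda > 0; by the second equation t ^+ 3 * lambda decreases. *)
Lemma cc_unique_outer_nonpos x y : 0 <= gij -> gik <= 0 -> 0 <= gjk ->
  sol x -> sol y -> ~ x < y.
Proof.
move=> g1 g2 g3 [lx lx0 [x0 Ax Bx]] [ly ly0 [y0 Ay By]] xy.
have x1 : 0 < 1 + x by rewrite addr_gt0.
have y1 : 0 < 1 + y by rewrite addr_gt0.
have lxy : lx <= ly.
  rewrite Ax Ay; apply: lerB; first apply: lerD => //.
    rewrite ler_wnM2l// lef_pV2 ?posrE ?mulr_gt0 ?exprn_gt0//.
    by rewrite ler_pM2l// lerXn2r ?nnegrE ?ltW// ltrD2l.
  rewrite ler_wpM2l// lef_pV2 ?posrE ?mulr_gt0 ?exprn_gt0//.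
  by rewrite ler_pM2l// lerXn2r ?nnegrE ?ltW.
have bxy : y ^+ 2 * (y * ly) <= x ^+ 2 * (x * lx).
  (* Multiplication by u^2 gathers the outer term into the square of u / (1 + u), which increases
     with u and has a nonpositive factor. *)
  have E u l : 0 < u -> u * l = gjk * (mj^-1 + mk^-1) / u ^+ 2
      + gik / (mk * (1 + u) ^+ 2) - gij / mj ->
      u ^+ 2 * (u * l) = gjk * (mj^-1 + mk^-1) + gik / mk * (u / (1 + u)) ^+ 2
      - gij / mj * u ^+ 2.
    move=> u0 ->; field.
    by rewrite !gt_eqF ?addr_gt0.
  rewrite (E _ _ x0 Bx) (E _ _ y0 By); apply: lerB; first apply: lerD => //.
    rewrite ler_wnM2l ?mulr_le0_ge0 ?invr_ge0 ?(ltW mk0)//.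
    rewrite lerXn2r ?nnegrE ?divr_ge0 ?ltW// ltr_pdivrMr// mulrAC ltr_pdivlMr//.
    by rewrite !mulrDr !mulr1 mulrC ltrD2r.
  rewrite (ler_wpM2l (divr_ge0 g1 (ltW mj0)))//.
  by rewrite lerXn2r ?nnegrE ?ltW.
suff : x ^+ 2 * (x * lx) < y ^+ 2 * (y * ly) by rewrite ltNge bxy.
rewrite !mulrA -!exprSr; apply: (@lt_le_trans _ _ (y ^+ 3 * lx)).
  by rewrite ltr_pM2r// ltrXn2r ?nnegrE ?ltW.
by rewrite ler_pM2l ?exprn_gt0.
Qed.

(** If the inequality fails, the cubic coefficient too is nonpositive; then no coefficient of the
    quintic is positive, which excludes positive roots. *)
Lemma cc_inner_nonpos x : gij <= 0 -> 0 <= gik -> 0 <= gjk -> sol x ->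
  gjk * mi < gik * mj.
Proof.
move=> g1 g2 g3 sx; rewrite ltNge; apply/negP; rewrite -/de -/be => bd.
have x0 : 0 < x by case: sx => ? ? [].
have := cc_poly_neq0 sx; rewrite (_ : cc_poly = 0) ?eqxx//.
have px := root_cc_poly sx.
have a0 : al <= 0 by rewrite mulr_le0_ge0// ltW.
have b0 : 0 <= be by rewrite mulr_ge0// ltW.
have d0 : 0 <= de by rewrite mulr_ge0// ltW.
have [ai aj bi bk] : [/\ al * mi <= 0, al * mj <= 0, 0 <= be * mi & be * mk <= de * mk].
  by split; rewrite ?ler_wpM2r ?mulr_le0_ge0 ?mulr_ge0// ltW.
have [dj dk] : 0 <= de * mj /\ 0 <= de * mk by split; rewrite mulr_ge0// ltW.
have cle i : cc_poly`_i <= 0.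
  by case: i => [|[|[|[|[|[|i]]]]]]; rewrite coef_Poly /= ?nth_nil//; lra.
move/rootP: px; rewrite horner_coef => /eqP; rewrite -oppr_eq0 -sumrN psumr_eq0; last first.
  by move=> i _; rewrite oppr_ge0 mulr_le0_ge0// exprn_ge0// ltW.
move=> /allP t0; apply/polyP => i; rewrite coef0.
have [ti|ti] := ltnP i (size cc_poly); last exact: nth_default.
have /= := t0 (Ordinal ti) (mem_index_enum _).
by rewrite oppr_eq0 mulf_eq0 expf_eq0 (gt_eqF x0) andbF orbF => /eqP.
Qed.

(** Only the cubic coefficient can be positive. Twisting at degree 3 deletes it and leaves a single
    sign change, hence one root fewer than the two that three solutions would produce. *)
Lemma cc_two_inner_nonpos x y z : gij <= 0 -> 0 <= gik -> 0 <= gjk ->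
  sol x -> sol y -> sol z -> x < y -> ~ y < z.
Proof.
move=> g1 g2 g3 sx sy sz xy yz.
have x0 : 0 < x by case: sx => ? ? [].
have [px py pz] := And3 (root_cc_poly sx) (root_cc_poly sy) (root_cc_poly sz).
have a0 : al <= 0 by rewrite mulr_le0_ge0// ltW.
have b0 : 0 <= be by rewrite mulr_ge0// ltW.
have d0 : 0 <= de by rewrite mulr_ge0// ltW.
have [ai aj bi] : [/\ al * mi <= 0, al * mj <= 0 & 0 <= be * mi].
  by split; rewrite ?ler_wpM2r ?mulr_le0_ge0 ?mulr_ge0// ltW.
have [dj dk] : 0 <= de * mj /\ 0 <= de * mk by split; rewrite mulr_ge0// ltW.
have [c [xc cy pc]] := root_twist 3 x0 xy px py.
have [d [yd dz pd]] := root_twist 3 (lt_trans x0 xy) yz py pz.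
have := cc_poly_neq0 sx; rewrite (twist_eq0 (k := 3) x0 px) ?eqxx//.
apply: oppr_inj; rewrite oppr0.
apply: (@one_sign_change R 3 _ c d); rewrite ?rootN ?(lt_trans x0 xc) ?(lt_trans cy yd)//.
  by case=> [|[|[|i]]] //= _; rewrite coefN coef_twist coef_Poly /=; lra.
by case=> [|[|[|[|[|[|i]]]]]] //= _; rewrite coefN coef_twist coef_Poly /= ?nth_nil ?mulr0 ?oppr0//; lra.
Qed.

(** Twisting at degrees 2 and 3 multiplies the coefficients by (i - 2)(i - 3), which is nonnegative
    and deletes both coefficients of open sign. One sign change remains, whereas four solutions
    would leave two roots. *)
Lemma cc_three_inner_nonpos x y z w : gij <= 0 -> gjk <= 0 ->
  sol x -> sol y -> sol z -> sol w -> x < y -> y < z -> ~ z < w.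
Proof.
move=> g1 g3 sx sy sz sw xy yz zw.
have x0 : 0 < x by case: sx => ? ? [].
have y0 := lt_trans x0 xy; have z0 := lt_trans y0 yz.
have [px py pz pw] := And4 (root_cc_poly sx) (root_cc_poly sy) (root_cc_poly sz) (root_cc_poly sw).
have a0 : al <= 0 by rewrite mulr_le0_ge0// ltW.
have d0 : de <= 0 by rewrite mulr_le0_ge0// ltW.
have [ai aj] : al * mi <= 0 /\ al * mj <= 0.
  by split; rewrite mulr_le0_ge0// ltW.
have [dj dk] : de * mj <= 0 /\ de * mk <= 0 by split; rewrite mulr_le0_ge0// ltW.
have [c [xc cy pc]] := root_twist 2 x0 xy px py.
have [d [yd dz pd]] := root_twist 2 y0 yz py pz.
have [e [ze ew pe]] := root_twist 2 z0 zw pz pw.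
have c0 := lt_trans x0 xc; have d0' := lt_trans y0 yd.
have [c' [cc' c'd pc']] := root_twist 3 c0 (lt_trans cy yd) pc pd.
have [d' [dd' d'e pd']] := root_twist 3 d0' (lt_trans dz ze) pd pe.
have := cc_poly_neq0 sx; rewrite (twist_eq0 (k := 2) x0 px) ?eqxx//.
apply: (twist_eq0 (k := 3) c0 pc).
apply: oppr_inj; rewrite oppr0.
apply: (@one_sign_change R 2 _ c' d'); rewrite ?rootN ?(lt_trans c0 cc') ?(lt_trans c'd dd')//.
  by case=> [|[|i]] //= _; rewrite coefN !coef_twist coef_Poly /=; lra.
by case=> [|[|[|[|[|[|i]]]]]] //= _; rewrite coefN !coef_twist coef_Poly /= ?nth_nil ?mulr0 ?oppr0//; lra.
Qed.

(** Body k is pushed away by both others while j is pulled towards i, so the gap between j and k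
    cannot contract. *)
Lemma no_cc_inner_nonneg x : 0 <= gij -> gik <= 0 -> gjk <= 0 -> ~ sol x.
Proof.
move=> g1 g2 g3 [lam lam0 [x0 _ E]].
have x1 : 0 < 1 + x by rewrite addr_gt0.
have : 0 < x * lam by rewrite mulr_gt0.
rewrite E ltNge => /negP; apply.
have h1 : gjk * (mj^-1 + mk^-1) / x ^+ 2 <= 0.
  by rewrite mulr_le0_ge0 ?invr_ge0 ?exprn_ge0 ?mulr_le0_ge0 ?addr_ge0 ?invr_ge0// ltW.
have h2 : gik / (mk * (1 + x) ^+ 2) <= 0.
  by rewrite mulr_le0_ge0 ?invr_ge0 ?mulr_ge0 ?exprn_ge0// ltW.
have h3 : 0 <= gij / mj by rewrite divr_ge0// ltW.
lra.
Qed.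

Lemma no_cc_nonpos x : gij <= 0 -> gik <= 0 -> gjk <= 0 -> ~ sol x.
Proof.
move=> g1 g2 g3 [lam lam0 [x0 E1 E2]].
have x1 : 0 < 1 + x by rewrite addr_gt0.
have : 0 < lam * (1 + x) by rewrite mulr_gt0.
have -> : lam * (1 + x) = gij / mi + gik * (mi^-1 + mk^-1) / (1 + x) ^+ 2
    + gjk / (mk * x ^+ 2).
  by rewrite mulrDr mulr1 [lam * x]mulrC E2 E1; field; rewrite !gt_eqF.
rewrite ltNge => /negP; apply; rewrite -oppr_ge0 !opprD -!mulNr.
by rewrite !addr_ge0 ?mulr_ge0 ?oppr_ge0 ?invr_ge0 ?addr_ge0 ?mulr_ge0 ?exprn_ge0 ?invr_ge0// ltW.
Qed.

End Counting.

(** The line is read from its other end and rescaled so that the new first gap is again 1. Lengths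
    are divided by t, hence the multiplier, of degree -3 in lengths, is multiplied by t^3. *)
Lemma ordered_cc_rev mi mj mk gij gik gjk t :
  0 < mi -> 0 < mj -> 0 < mk ->
  ordered_cc mi mj mk gij gik gjk t -> ordered_cc mk mj mi gjk gik gij t^-1.
Proof.
move=> mi0 mj0 mk0 [lam lam0 [t0 E1 E2]].
have t1 : 1 + t != 0 by rewrite gt_eqF// addr_gt0.
have tt : 1 + t^-1 = (1 + t) / t by field; rewrite gt_eqF.
exists (t ^+ 3 * lam); first by rewrite mulr_gt0// exprn_gt0.
split; rewrite ?invr_gt0//.
  have -> : t ^+ 3 * lam = t ^+ 2 * (t * lam) by ring.
  by rewrite E2 tt; field; rewrite t1 !gt_eqF.
have -> : t^-1 * (t ^+ 3 * lam) = t ^+ 2 * lam by field; rewrite gt_eqF.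
by rewrite E1 tt; field; rewrite t1 !gt_eqF.
Qed.

End OrderedTriple.

(** * Counting shapes *)

Section AtMost.

(** Bounding duplicate-free lists avoids any prior knowledge of finiteness, which [atmost_card]
    derives from the bound. *)
Definition atmost (T : eqType) (n : nat) (A : set T) : Prop :=
  forall s : seq T, uniq s -> (forall x, x \in s -> A x) -> (size s <= n)%N.

Lemma atmost_sub (T : eqType) m n (A B : set T) :
  (m <= n)%N -> A `<=` B -> atmost m B -> atmost n A.
Proof.
move=> mn AB Bm s us sA; apply: leq_trans mn; apply: Bm => // x xs.
exact/AB/sA.
Qed.

Lemma atmost0 (T : eqType) (A : set T) : (forall x, ~ A x) -> atmost 0 A.
Proof. by move=> A0 [//|x s] _ /(_ x (mem_head _ _)) /A0. Qed.

Lemma atmostU (T : eqType) m n (A B : set T) :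
  atmost m A -> atmost n B -> atmost (m + n) (A `|` B).
Proof.
move=> Am Bn s us sAB; rewrite -(count_predC (fun x => `[< A x >]) s) -!size_filter.
apply: leq_add; [apply: Am|apply: Bn]; rewrite ?filter_uniq// => x;
  rewrite mem_filter => /andP[] /=; first by move/asboolP.
by move=> /asboolPn nAx /sAB [].
Qed.

Lemma atmost_inj (T U : eqType) n (f : T -> U) (A : set T) (B : set U) :
  (forall x, A x -> B (f x)) ->
  (forall x y, A x -> A y -> f x = f y -> x = y) -> atmost n B -> atmost n A.
Proof.
move=> fAB finj Bn s us sA; rewrite -(size_map f); apply: Bn.
  by rewrite map_inj_in_uniq// => x y /sA Ax /sA Ay; exact: finj.
by move=> _ /mapP[x xs ->]; apply/fAB/sA.
Qed.

Lemma atmost_sorted (R : realType) n (A : set R) :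
  (forall s, size s = n.+1 -> sorted <%R s -> (forall x, x \in s -> A x) -> False) ->
  atmost n A.
Proof.
move=> An s us sA; rewrite leqNgt; apply/negP => ns.
apply: (An (take n.+1 (sort <=%R s))).
- by rewrite size_takel// size_sort.
- by apply: take_sorted; rewrite sort_lt_sorted.
- by move=> x /mem_take; rewrite mem_sort => /sA.
Qed.

Lemma atmost_card (T : choiceType) n (A : set T) : atmost n A ->
  exists2 k, (k <= n)%N & (A #= `I_k)%card.
Proof.
move=> An; have [/finite_fsetP[X AX]|Ainf] := pselect (finite_set A).
  exists #|` X|; last by rewrite AX; apply/card_eq_fsetP.
  by apply: An => [|x]; [exact: fset_uniq|rewrite AX].
have [X XA nX] := infinite_set_fset n.+1 Ainf.
by have := An _ (fset_uniq X) XA; rewrite leqNgt nX.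
Qed.

Lemma card_geq_uniq (T : choiceType) k (A : set T) (s : seq T) :
  (A #= `I_k)%card -> uniq s -> (forall x, x \in s -> A x) -> (size s <= k)%N.
Proof.
move=> Ak us sA.
have /finite_fsetP[X AX] : finite_set A by apply/finite_setP; exists k.
move: Ak sA; rewrite {}AX => /card_eq_fsetP <- sX.
exact: uniq_leq_size.
Qed.

End AtMost.

Section Shapes.
Context {R : realType}.
Implicit Types (mi mj mk gij gik gjk : R) (x : R).

Section OneOrder.
Variables mi mj mk gij gik gjk : R.
Hypotheses (mi0 : 0 < mi) (mj0 : 0 < mj) (mk0 : 0 < mk).
Let sol : set R := ordered_cc mi mj mk gij gik gjk.

Lemma atmost_cc_nonneg : 0 <= gij -> 0 <= gik -> 0 <= gjk -> atmost 1 sol.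
Proof.
move=> g1 g2 g3; apply: atmost_sorted => -[//|x [//|y [|//]]] _ /= /andP[xy _] A.
by apply: (cc_unique_nonneg mi0 mj0 mk0 g1 g2 g3 _ _ xy) => //; apply: A; rewrite !inE eqxx ?orbT.
Qed.

Lemma atmost_cc_outer_nonpos : 0 <= gij -> gik <= 0 -> 0 <= gjk -> atmost 1 sol.
Proof.
move=> g1 g2 g3; apply: atmost_sorted => -[//|x [//|y [|//]]] _ /= /andP[xy _] A.
by apply: (cc_unique_outer_nonpos mi0 mj0 mk0 g1 g2 g3 _ _ xy) => //; apply: A; rewrite !inE eqxx ?orbT.
Qed.

(** The bound keeps the inequality as a conditional so that the bounds for two orders with opposite
    inequalities can be added without exceeding 2. *)
Lemma atmost_cc_inner_nonpos : gij <= 0 -> 0 <= gik -> 0 <= gjk ->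
  atmost (if gjk * mi < gik * mj then 2 else 0) sol.
Proof.
move=> g1 g2 g3; case: ifPn => [_|/negP ng]; last first.
  by apply: atmost0 => x /(cc_inner_nonpos mi0 mj0 mk0 g1 g2 g3).
apply: atmost_sorted => -[//|x [//|y [//|z [|//]]]] _ /= /and3P[xy yz _] A.
by apply: (cc_two_inner_nonpos mi0 mj0 mk0 g1 g2 g3 _ _ _ xy yz) => //; apply: A; rewrite !inE eqxx ?orbT.
Qed.

Lemma atmost_cc_outer_nonneg : gij <= 0 -> gjk <= 0 -> atmost 3 sol.
Proof.
move=> g1 g3.
apply: atmost_sorted => -[//|x [//|y [//|z [//|w [|//]]]]] _ /= /and4P[xy yz zw _] A.
by apply: (cc_three_inner_nonpos mi0 mj0 mk0 g1 g3 _ _ _ _ xy yz zw) => //; apply: A; rewrite !inE eqxx ?orbT.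
Qed.

Lemma atmost_cc_inner_nonneg : 0 <= gij -> gik <= 0 -> gjk <= 0 -> atmost 0 sol.
Proof. by move=> g1 g2 g3; apply: atmost0 => x; exact: no_cc_inner_nonneg. Qed.

Lemma atmost_cc_nonpos : gij <= 0 -> gik <= 0 -> gjk <= 0 -> atmost 0 sol.
Proof. by move=> g1 g2 g3; apply: atmost0 => x; exact: no_cc_nonpos. Qed.

Lemma atmost_cc_rev n : atmost n (ordered_cc mk mj mi gjk gik gij) -> atmost n sol.
Proof.
apply: (@atmost_inj _ _ _ (fun t => t^-1)) => [x|x y _ _ /invr_inj //].
exact: ordered_cc_rev.
Qed.

End OneOrder.

Variables m0 m1 m2 g01 g02 g12 : R.
Hypotheses (m0_gt0 : 0 < m0) (m1_gt0 : 0 < m1) (m2_gt0 : 0 < m2).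

(* The shape of collinear bodies at positions s0, s1, s2 is
   (s1 - s0) / (s2 - s0); the middle body is 1, 2 or 0, respectively. *)
Definition shapes : set R :=
  [set x | [/\ 0 < x, x < 1 & ordered_cc m0 m1 m2 g01 g02 g12 ((1 - x) / x)]] `|`
  [set x | 1 < x /\ ordered_cc m0 m2 m1 g02 g01 g12 (x - 1)] `|`
  [set x | x < 0 /\ ordered_cc m1 m0 m2 g01 g12 g02 (- x^-1)].

Lemma atmost_shapes a b c :
  atmost a (ordered_cc m0 m1 m2 g01 g02 g12) ->
  atmost b (ordered_cc m0 m2 m1 g02 g01 g12) ->
  atmost c (ordered_cc m1 m0 m2 g01 g12 g02) -> atmost (a + b + c) shapes.
Proof.
move=> ha hb hc; apply: atmostU; first apply: atmostU.
- apply: (atmost_inj (f := fun x => (1 - x) / x)) ha => [x []//|x y [x0 _ _] [y0 _ _] /eqP].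
  rewrite eqr_div; [move=> /eqP E|by rewrite gt_eqF..].
  suff: x - y = (1 - y) * x - (1 - x) * y by rewrite -E subrr => /subr0_eq.
  by ring.
- by apply: (atmost_inj (f := fun x => x - 1)) hb => [x []//|x y _ _ /addIr].
- by apply: (atmost_inj (f := fun x => - x^-1)) hc => [x []//|x y _ _ /oppr_inj /invr_inj].
Qed.

Lemma atmost3_shapes : atmost 3 shapes.
Proof.
have ex a b c : atmost a (ordered_cc m0 m1 m2 g01 g02 g12) ->
   atmost b (ordered_cc m0 m2 m1 g02 g01 g12) ->
   atmost c (ordered_cc m1 m0 m2 g01 g12 g02) -> (a + b + c <= 3)%N -> atmost 3 shapes.
  by move=> ha hb hc abc; apply: atmost_sub abc _ (atmost_shapes ha hb hc).
have E (u v : R) : ((if (u < v)%R then 2 else 0) + (if (v < u)%R then 2 else 0) <= 2)%N.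
  by case: ltgtP.
have [p01|/ltW n01] := lerP 0 g01; have [p02|/ltW n02] := lerP 0 g02;
  have [p12|/ltW n12] := lerP 0 g12.
- by apply: (@ex 1 1 1)%N; rewrite ?addnA//; apply: atmost_cc_nonneg.
- apply: (@ex (if (g01 * m2 < g02 * m1)%R then 2 else 0) (if (g02 * m1 < g01 * m2)%R then 2 else 0) 1).
  + by apply: atmost_cc_rev => //; apply: atmost_cc_inner_nonpos.
  + by apply: atmost_cc_rev => //; apply: atmost_cc_inner_nonpos.
  + exact: atmost_cc_outer_nonpos.
  + by rewrite addn1 ltnS.
- apply: (@ex 1 (if (g12 * m0 < g01 * m2)%R then 2 else 0) (if (g01 * m2 < g12 * m0)%R then 2 else 0)).
  + exact: atmost_cc_outer_nonpos.
  + exact: atmost_cc_inner_nonpos.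
  + by apply: atmost_cc_rev => //; apply: atmost_cc_inner_nonpos.
  + by rewrite -addnA add1n ltnS.
(* Only [g01] is nonnegative, so bodies 0 and 1 have to be at the ends, with body 2 in the
   middle. *)
- apply: (@ex 0 3 0)%N => //; first exact: atmost_cc_inner_nonneg.
    exact: atmost_cc_outer_nonneg.
  exact: atmost_cc_inner_nonneg.
- apply: (@ex (if (g12 * m0 < g02 * m1)%R then 2 else 0) 1 (if (g02 * m1 < g12 * m0)%R then 2 else 0)).
  + exact: atmost_cc_inner_nonpos.
  + exact: atmost_cc_outer_nonpos.
  + exact: atmost_cc_inner_nonpos.
  + by rewrite addn1 addSn ltnS.
- apply: (@ex 3 0 0)%N => //; first exact: atmost_cc_outer_nonneg.
    exact: atmost_cc_inner_nonneg.
  by apply: atmost_cc_rev => //; exact: atmost_cc_inner_nonneg.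
- apply: (@ex 0 0 3)%N => //; last exact: atmost_cc_outer_nonneg.
    by apply: atmost_cc_rev => //; exact: atmost_cc_inner_nonneg.
  by apply: atmost_cc_rev => //; exact: atmost_cc_inner_nonneg.
- by apply: (@ex 0 0 0)%N => //; apply: atmost_cc_nonpos.
Qed.

End Shapes.

(** * Euclidean geometry of R^3 *)

Lemma det_mx22 (K : comNzRingType) (A : 'M[K]_2) : \det A = A 0 0 * A 1 1 - A 0 1 * A 1 0.
Proof.
rewrite (expand_det_row _ 0) !big_ord_recl big_ord0 /cofactor !det_mx11 !mxE /=.
rewrite expr0 expr1 mul1r addr0 mulN1r mulrN.
by congr (_ * A _ _ - A _ _ * A _ _); apply: val_inj.
Qed.
Lemma det_mx33 (K : comNzRingType) (A : 'M[K]_3) : \det A =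
  A 0 0 * (A 1 1 * A 2 2 - A 1 2 * A 2 1) - A 0 1 * (A 1 0 * A 2 2 - A 1 2 * A 2 0)
  + A 0 2 * (A 1 0 * A 2 1 - A 1 1 * A 2 0).
Proof.
rewrite (expand_det_row _ 0) !big_ord_recl big_ord0 /cofactor !det_mx22 !mxE.
rewrite [(-1) ^+ _]expr0 [(-1) ^+ _]expr1 /bump /= -signr_odd /=.
rewrite expr0 addr0 !mul1r mulN1r mulrN addrA.
by congr (_ * (A _ _ * A _ _ - A _ _ * A _ _) - A _ _ * (A _ _ * A _ _ - A _ _ * A _ _)
  + A _ _ * (A _ _ * A _ _ - A _ _ * A _ _)); apply: val_inj.
Qed.

Section Vectors.
Context {R : realType}.
Implicit Types (u v w e : 'rV[R]_3) (a b : R).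

Lemma sum3E (V : nmodType) (F : 'I_3 -> V) : \sum_(i < 3) F i = F 0 + F 1 + F 2.
Proof.
rewrite !big_ord_recl big_ord0 addr0 addrA.
by congr (F _ + F _ + F _); apply: val_inj.
Qed.

Lemma ord3P (i : 'I_3) : [\/ i = 0, i = 1 | i = 2].
Proof.
case: i => [[|[|[|//]]] h]; [apply: Or31|apply: Or32|apply: Or33]; exact: val_inj.
Qed.

Lemma forall3 (P : 'I_3 -> Prop) : P 0 -> P 1 -> P 2 -> forall i, P i.
Proof. by move=> p0 p1 p2 i; case: (ord3P i) => ->. Qed.

Lemma rV3P u v : u 0 0 = v 0 0 -> u 0 1 = v 0 1 -> u 0 2 = v 0 2 -> u = v.
Proof. by move=> h0 h1 h2; apply/rowP; apply: forall3. Qed.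

Lemma dotE u v : dot u v = u 0 0 * v 0 0 + u 0 1 * v 0 1 + u 0 2 * v 0 2.
Proof. by rewrite /dot mxE sum3E !mxE. Qed.

Lemma crossE u v : (cross u v 0 0 = u 0 1 * v 0 2 - u 0 2 * v 0 1) *
  (cross u v 0 1 = u 0 2 * v 0 0 - u 0 0 * v 0 2) *
  (cross u v 0 2 = u 0 0 * v 0 1 - u 0 1 * v 0 0).
Proof.
have [E1 E2 E3 E4] : [/\ (1 + 1 = 2 :> 'I_3), (1 + 2 = 0 :> 'I_3),
   (2 + 1 = 0 :> 'I_3) & (2 + 2 = 1 :> 'I_3)] by split; apply: val_inj.
by rewrite !mxE !add0r E1 E2 E3 E4.
Qed.

Lemma dotC u v : dot u v = dot v u.
Proof. by rewrite !dotE; ring. Qed.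

Lemma dotDl u v w : dot (u + v) w = dot u w + dot v w.
Proof. by rewrite !dotE !mxE; ring. Qed.

Lemma dotZl a u w : dot (a *: u) w = a * dot u w.
Proof. by rewrite !dotE !mxE; ring. Qed.

Lemma dotDr u v w : dot u (v + w) = dot u v + dot u w.
Proof. by rewrite !dotE !mxE; ring. Qed.

Lemma dotZr a u w : dot u (a *: w) = a * dot u w.
Proof. by rewrite !dotE !mxE; ring. Qed.

Lemma dotNl u w : dot (- u) w = - dot u w.
Proof. by rewrite !dotE !mxE; ring. Qed.

Lemma dotNr u w : dot u (- w) = - dot u w.
Proof. by rewrite !dotE !mxE; ring. Qed.

Lemma dot0l u : dot 0 u = 0.
Proof. by rewrite !dotE !mxE; ring. Qed.

Lemma dot_ge0 u : 0 <= dot u u.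
Proof. by rewrite dotE -!expr2 !addr_ge0 ?sqr_ge0. Qed.

Lemma dot_eq0 u : (dot u u == 0) = (u == 0).
Proof.
apply/idP/eqP => [|->]; last by rewrite dot0l.
rewrite dotE -!expr2 !paddr_eq0 ?addr_ge0 ?sqr_ge0// !sqrf_eq0.
by case/andP => /andP[/eqP h0 /eqP h1] /eqP h2; apply: rV3P; rewrite mxE.
Qed.

Lemma dot_gt0 u : (0 < dot u u) = (u != 0).
Proof. by rewrite lt0r dot_eq0 dot_ge0 andbT. Qed.

Lemma enorm_sqr u : enorm u ^+ 2 = dot u u.
Proof. by rewrite sqr_sqrtr// dot_ge0. Qed.

Lemma enorm_ge0 u : 0 <= enorm u.
Proof. exact: sqrtr_ge0. Qed.

Lemma enorm_gt0 u : (0 < enorm u) = (u != 0).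
Proof. by rewrite sqrtr_gt0 dot_gt0. Qed.

Lemma enormZ a u : enorm (a *: u) = `|a| * enorm u.
Proof. by rewrite /enorm dotZl dotZr mulrA -expr2 sqrtrM ?sqr_ge0// sqrtr_sqr. Qed.

Lemma enormN u : enorm (- u) = enorm u.
Proof. by rewrite -scaleN1r enormZ normrN1 mul1r. Qed.

Lemma dot_crossA e u v : dot e (cross u v) = dot (cross e u) v.
Proof. by rewrite !dotE !crossE; ring. Qed.

Lemma cross_cross e u : dot e u = 0 -> cross (cross e u) e = dot e e *: u.
Proof.
move=> eu.
suff -> : cross (cross e u) e = dot e e *: u - dot e u *: e.
  by rewrite eu scale0r subr0.
by apply: rV3P; rewrite !(crossE, dotE, mxE); ring.
Qed.

Lemma crossC u v : cross u v = - cross v u.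
Proof. by apply: rV3P; rewrite !(crossE, mxE); ring. Qed.

Lemma crossDl u v w : cross (u + v) w = cross u w + cross v w.
Proof. by apply: rV3P; rewrite !(crossE, mxE); ring. Qed.

Lemma crossZl a u v : cross (a *: u) v = a *: cross u v.
Proof. by apply: rV3P; rewrite !(crossE, mxE); ring. Qed.

Lemma crossDr u v w : cross w (u + v) = cross w u + cross w v.
Proof. by apply: rV3P; rewrite !(crossE, mxE); ring. Qed.

Lemma crossZr a u v : cross v (a *: u) = a *: cross v u.
Proof. by apply: rV3P; rewrite !(crossE, mxE); ring. Qed.

Lemma dot_cross u v :
  [/\ dot u (cross u v) = 0, dot v (cross u v) = 0 &
  dot (cross u v) (cross u v) = dot u u * dot v v - dot u v ^+ 2].
Proof. by split; rewrite !(dotE, crossE); ring. Qed.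

Lemma dot_orthogonal (A : 'M[R]_3) u v : A *m A^T = 1%:M ->
  dot (u *m A) (v *m A) = dot u v.
Proof. by move=> AA; rewrite /dot trmx_mul mulmxA -(mulmxA u) AA mulmx1. Qed.

Definition frame u v w : 'M[R]_3 :=
  \matrix_(i < 3) (if i == 0 then u else if i == 1 then v else w).

Lemma row_frame u v w : (row 0 (frame u v w) = u) * (row 1 (frame u v w) = v) *
  (row 2 (frame u v w) = w).
Proof. by rewrite !rowK. Qed.

Lemma frame_gram (A B : 'M[R]_3) i j : (A *m B^T) i j = dot (row i A) (row j B).
Proof. by rewrite /dot !mxE; apply: eq_bigr => k _; rewrite !mxE. Qed.

Lemma det_frame u v w : \det (frame u v w) = dot (cross u v) w.
Proof.
by rewrite det_mx33 !mxE /= dotE !crossE; ring.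
Qed.

(** Each pair is completed by its cross product to a frame. The two frames have the same Gram
    matrix, so U^-1 U' is orthogonal; their determinants are both the Gram determinant of the pair,
    so it is a rotation. Mirror images of a triangle in its plane are therefore identified as
    well. *)
Lemma exists_rotation u v u' v' : dot u u * dot v v - dot u v ^+ 2 != 0 ->
  dot u' u' = dot u u -> dot v' v' = dot v v -> dot u' v' = dot u v ->
  exists A : 'M[R]_3, [/\ A *m A^T = 1%:M, \det A = 1, u *m A = u' & v *m A = v'].
Proof.
move=> D0 uu vv uv.
pose U := frame u v (cross u v); pose U' := frame u' v' (cross u' v').
have detU : \det U != 0 by rewrite det_frame; case: (dot_cross u v) => _ _ ->.
have detE : \det U' = \det U.
  rewrite !det_frame; case: (dot_cross u v) => _ _ ->.
  by case: (dot_cross u' v') => _ _ ->; rewrite uu vv uv.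
have Uu : U \in unitmx by rewrite unitmxE unitfE.
have GE : U *m U^T = U' *m U'^T.
  have [a b c] := dot_cross u v; have [a' b' c'] := dot_cross u' v'.
  have vu : dot v' u' = dot v u by rewrite dotC uv dotC.
  apply/matrixP => i j; rewrite !frame_gram.
  by case: (ord3P i) => ->; case: (ord3P j) => ->;
    rewrite !row_frame ?(dotC (cross u v)) ?(dotC (cross u' v')) ?a ?a' ?b ?b' ?c ?c' ?uu ?vv
      ?vu ?uv.
pose A := invmx U *m U'.
have UA : U *m A = U' by rewrite /A mulmxA mulmxV// mul1mx.
have rowA i : row i U *m A = row i U' by rewrite -row_mul UA.
exists A; split.
- rewrite /A trmx_mul mulmxA -(mulmxA _ U') -GE mulmxA mulVmx// mul1mx trmx_inv mulmxV//.
  by rewrite unitmx_tr.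
- by rewrite /A det_mulmx det_inv detE mulVf.
- by have := rowA 0; rewrite !row_frame.
- by have := rowA 1; rewrite !row_frame.
Qed.

Lemma exists_perp u : u != 0 -> exists v, dot u v = 0 /\ dot v v = 1.
Proof.
move=> u0.
suff [w w0 uw] : exists2 w, w != 0 & dot u w = 0.
  exists ((enorm w)^-1 *: w); rewrite !dotZl !dotZr uw mulr0; split => //.
  by rewrite -enorm_sqr mulrA -invfM -expr2 mulVf// expf_neq0// gt_eqF ?enorm_gt0.
have [u00|u00] := eqVneq (u 0 0) 0.
  exists (delta_mx 0 0); last by rewrite dotE !mxE /= u00; ring.
  by apply/eqP => /rowP /(_ 0) /eqP; rewrite !mxE /= oner_eq0.
exists (\row_(j < 3) (if j == 0 then - u 0 1 else if j == 1 then u 0 0 else 0)).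
  by apply/eqP => /rowP /(_ 1) /eqP; rewrite !mxE /= (negbTE u00).
by rewrite dotE !mxE /=; ring.
Qed.

(** The substitute for [exists_rotation] on a line, where the two sides are dependent: a
    perpendicular unit vector supplies the second vector. *)
Lemma exists_rotation1 u u' : u != 0 -> dot u' u' = dot u u ->
  exists A : 'M[R]_3, [/\ A *m A^T = 1%:M, \det A = 1 & u *m A = u'].
Proof.
move=> u0 uu; have u'0 : u' != 0 by rewrite -dot_gt0 uu dot_gt0.
have [v [uv vv]] := exists_perp u0; have [v' [uv' vv']] := exists_perp u'0.
have [|//|||A [AA dA uA _]] := @exists_rotation u v u' v'.
- by rewrite uv vv expr0n subr0 mulr1 dot_eq0.
- by rewrite vv.
- by rewrite uv.
by exists A.
Qed.

End Vectors.

(** * Central configurations and critical points *)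

Section Derivatives.
Context {R : realType}.
Implicit Types (u w : 'rV[R]_3) (q v : 'M[R]_3) (m : 'I_3 -> R) (g : 'I_3 -> 'I_3 -> R).

Lemma derive_line (V W : normedModType R) (f : V -> W) (x v : V) :
  'D_v f x = 'D_1 (fun h : R => f (h *: v + x)) (0 : R).
Proof.
rewrite /derive; do 2 f_equal; apply/funext => h /=.
by rewrite addr0 scale0r add0r [_%:A]mulr1.
Qed.

Lemma is_derive_quadratic (a b c : R) :
  is_derive (0 : R) 1 (fun h : R => a + h * b + h ^+ 2 * c) b.
Proof.
have -> : (fun h : R => a + h * b + h ^+ 2 * c) = horner (Poly [:: a; b; c]).
  by apply/funext => h; rewrite horner_Poly /=; ring.
apply: is_derive_eq; rewrite horner_coef0 coef_deriv coef_Poly /=.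
by rewrite mulr1n.
Qed.

Lemma dot_line u w (h : R) :
  dot (h *: u + w) (h *: u + w) = dot w w + h * (2 * dot w u) + h ^+ 2 * dot u u.
Proof. by rewrite dotDl !dotDr !dotZl !dotZr (dotC u w); ring. Qed.

Lemma is_derive_inv_enorm u w : w != 0 ->
  is_derive (0 : R) 1 (fun h : R => (enorm (h *: u + w))^-1)
    (- (dot w u / enorm w ^+ 3)).
Proof.
move=> w0.
pose Q (h : R) := dot w w + h * (2 * dot w u) + h ^+ 2 * dot u u.
have -> : (fun h : R => (enorm (h *: u + w))^-1) = GRing.inv \o (Num.sqrt \o Q).
  by apply/funext => h /=; rewrite /enorm dot_line.
have Q0 : Q 0 = dot w w by rewrite /Q; ring.
have dQ : is_derive (0 : R) 1 Q (2 * dot w u) by exact: is_derive_quadratic.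
have dS : is_derive (Q 0) 1 Num.sqrt (2 * Num.sqrt (Q 0))^-1.
  by apply: is_derive1_sqrt; rewrite Q0 dot_gt0.
have SQ : Num.sqrt (Q 0) = enorm w by rewrite Q0.
have en0 : enorm w != 0 by rewrite gt_eqF// enorm_gt0.
have dV : is_derive ((Num.sqrt \o Q) 0) 1 (GRing.inv : R -> R) (- enorm w ^- 2).
  have E : (Num.sqrt \o Q) 0 = enorm w by [].
  apply: DeriveDef; rewrite E; first exact: derivableV.
  by rewrite deriveV// derive_id scaler1.
apply: (is_derive_eq (is_derive1_comp _ _)).
by rewrite SQ; field.
Qed.

Definition potential_diff g q v : R :=
  g 0 1 * (dot (row 0 q - row 1 q) (row 0 v - row 1 v) / enorm (row 0 q - row 1 q) ^+ 3) +
  g 0 2 * (dot (row 0 q - row 2 q) (row 0 v - row 2 v) / enorm (row 0 q - row 2 q) ^+ 3) +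
  g 1 2 * (dot (row 1 q - row 2 q) (row 1 v - row 2 v) / enorm (row 1 q - row 2 q) ^+ 3).

Lemma potentialE g q : potential g q =
  - (g 0 1 / enorm (row 0 q - row 1 q) + g 0 2 / enorm (row 0 q - row 2 q)
     + g 1 2 / enorm (row 1 q - row 2 q)).
Proof.
rewrite /potential; under eq_bigr do rewrite big_mkcond sum3E.
by rewrite /potential sum3E /= !add0r !addr0.
Qed.

Lemma configurationP q : configuration q <->
  [/\ row 0 q - row 1 q != 0, row 0 q - row 2 q != 0 & row 1 q - row 2 q != 0].
Proof.
rewrite !subr_eq0; split => [c|[h1 h2 h3] i j].
  by split; exact: c.
case: (ord3P i) => ->; case: (ord3P j) => -> // _; by rewrite // eq_sym.
Qed.

Lemma is_derive_potential_line g q v : configuration q ->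
  is_derive (0 : R) 1 (fun h : R => potential g (h *: v + q)) (potential_diff g q v).
Proof.
move=> /configurationP[h01 h02 h12].
have rE i j (h : R) : row i (h *: v + q) - row j (h *: v + q) =
    h *: (row i v - row j v) + (row i q - row j q).
  by apply/rowP => k; rewrite !mxE; ring.
have -> : (fun h : R => potential g (h *: v + q)) =
   (- g 0 1) *: (fun h : R => (enorm (h *: (row 0 v - row 1 v) + (row 0 q - row 1 q)))^-1) +
   (- g 0 2) *: (fun h : R => (enorm (h *: (row 0 v - row 2 v) + (row 0 q - row 2 q)))^-1) +
   (- g 1 2) *: (fun h : R => (enorm (h *: (row 1 v - row 2 v) + (row 1 q - row 2 q)))^-1).
  by apply/funext => h; rewrite potentialE !rE !fctE/= /GRing.scale/=; ring.
have d01 := is_derive_inv_enorm (row 0 v - row 1 v) h01.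
have d02 := is_derive_inv_enorm (row 0 v - row 2 v) h02.
have d12 := is_derive_inv_enorm (row 1 v - row 2 v) h12.
apply: (is_derive_eq (is_deriveD (is_deriveD (is_deriveZ _ d01)
  (is_deriveZ _ d02)) (is_deriveZ _ d12))).
by rewrite /potential_diff /GRing.scale/=; ring.
Qed.

Lemma derive_potential g q v : configuration q ->
  'D_v (potential g) q = potential_diff g q v.
Proof.
move=> cq; rewrite derive_line.
exact: (@derive_val _ _ _ _ _ _ _ (is_derive_potential_line g v cq)).
Qed.

Lemma central_configurationP m g q lambda : central_configuration m g q lambda <->
  configuration q /\
  [/\ (lambda * m 0) *: (row 0 q - center_of_mass m q) =
      (g 0 1 / enorm (row 0 q - row 1 q) ^+ 3) *: (row 0 q - row 1 q) +
      (g 0 2 / enorm (row 0 q - row 2 q) ^+ 3) *: (row 0 q - row 2 q),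
    (lambda * m 1) *: (row 1 q - center_of_mass m q) =
      - ((g 0 1 / enorm (row 0 q - row 1 q) ^+ 3) *: (row 0 q - row 1 q)) +
      (g 1 2 / enorm (row 1 q - row 2 q) ^+ 3) *: (row 1 q - row 2 q) &
    (lambda * m 2) *: (row 2 q - center_of_mass m q) =
      - ((g 0 2 / enorm (row 0 q - row 2 q) ^+ 3) *: (row 0 q - row 2 q)) -
      (g 1 2 / enorm (row 1 q - row 2 q) ^+ 3) *: (row 1 q - row 2 q)].
Proof.
have rd (i j k : 'I_3) (w : 'rV[R]_3) : dot w (row j (delta_mx i k)) = w 0 k *+ (j == i).
  rewrite /dot mxE (bigD1 k)//= big1 ?addr0 => [|l lk].
    by rewrite !mxE eqxx andbT; case: eqP => _; rewrite ?mulr1 ?mulr0.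
  by rewrite !mxE (negbTE lk) andbF mulr0.
split=> -[cq E]; split => //.
  split; apply/rowP => k; move: (E 0 k) (E 1 k) (E 2 k);
  rewrite !derive_potential// /potential_diff !dotDr !dotNr !rd /= !mxE.
  - by move=> <- _ _; ring.
  - by move=> _ <- _; ring.
  - by move=> _ _ <-; ring.
case: E => E0 E1 E2 i k; rewrite derive_potential// /potential_diff !dotDr !dotNr !rd.
move/rowP: E0 => /(_ k); move/rowP: E1 => /(_ k); move/rowP: E2 => /(_ k).
rewrite !mxE.
by case: (ord3P i) => -> h2 h1 h0; rewrite /= ?h0 ?h1 ?h2; ring.
Qed.

End Derivatives.

(** * Relative equilibria as critical points of the integral map *)

Section Critical.
Context {R : realType}.
Implicit Types (m : 'I_3 -> R) (g : 'I_3 -> 'I_3 -> R) (z : phase R) (e : 'rV[R]_3).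

Lemma differentiable_fst (V W : normedModType R) (z : V * W) :
  differentiable (fst : V * W -> V) z.
Proof.
apply: linear_differentiable => p; exact: cvg_fst.
Qed.

Lemma differentiable_snd (V W : normedModType R) (z : V * W) :
  differentiable (snd : V * W -> W) z.
Proof.
apply: linear_differentiable => p; exact: cvg_snd.
Qed.

Lemma differentiable_q z i k : differentiable (fun z : phase R => z.1 i k : R^o) z.
Proof.
apply: (@differentiable_comp _ _ _ _ (fst : phase R -> _) (fun M => M i k : R^o)).
  exact: differentiable_fst.
exact: differentiable_coord.
Qed.

Lemma differentiable_p z i k : differentiable (fun z : phase R => z.2 i k : R^o) z.
Proof.
apply: (@differentiable_comp _ _ _ _ (snd : phase R -> _) (fun M => M i k : R^o)).
  exact: differentiable_snd.
exact: differentiable_coord.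
Qed.

Lemma differentiable_row (V : normedModType R) (f : V -> 'rV[R]_3) (x : V) :
  (forall k, differentiable (fun y => f y 0 k : R^o) x) -> differentiable f x.
Proof.
move=> df.
have -> : f = \sum_(k < 3) (fun y => (f y 0 k) *: (delta_mx 0 k : 'rV[R]_3)).
  apply/funext => y; rewrite fct_sumE [LHS]row_sum_delta//.
apply: differentiable_sum => k; exact: differentiableZl.
Qed.

Lemma differentiable_dot (V : normedModType R) (f h : V -> 'rV[R]_3) (x : V) :
  (forall k, differentiable (fun y => f y 0 k : R^o) x) -> 
  (forall k, differentiable (fun y => h y 0 k : R^o) x) -> 
  differentiable (fun y => dot (f y) (h y) : R^o) x.
Proof.
move=> df dh.
have -> : (fun y => dot (f y) (h y) : R^o) =
  \sum_(k < 3) ((fun y => f y 0 k : R^o) * (fun y => h y 0 k : R^o)).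
  by apply/funext => y; rewrite fct_sumE dotE sum3E.
by apply: differentiable_sum => k; apply: differentiableM.
Qed.

Lemma differentiable_inv_enorm (V : normedModType R) (f : V -> 'rV[R]_3) (x : V) :
  (forall k, differentiable (fun y => f y 0 k : R^o) x) -> f x != 0 ->
  differentiable (fun y => (enorm (f y))^-1 : R^o) x.
Proof.
move=> df fx0; apply: differentiableV; last by rewrite gt_eqF// enorm_gt0.
apply: (@differentiable_comp _ _ _ _ (fun y => dot (f y) (f y) : R^o) (Num.sqrt : R^o -> R^o)).
  exact: differentiable_dot.
apply/derivable1_diffP.
have dfx : 0 < dot (f x) (f x) by rewrite dot_gt0.
by have [] := is_derive1_sqrt dfx.
Qed.

Lemma differentiable_hamiltonian m g z : configuration z.1 ->
  differentiable (hamiltonian m g : phase R -> R^o) z.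
Proof.
move=> /configurationP[h01 h02 h12].
pose V i j := fun z : phase R => (enorm (row i z.1 - row j z.1))^-1 : R^o.
have -> : (hamiltonian m g : phase R -> R^o) =
    \sum_(i < 3) (((2 * m i)^-1 : R) *: (fun z : phase R => dot (row i z.2) (row i z.2) : R^o))
    - (g 0 1 *: V 0 1 + g 0 2 *: V 0 2 + g 1 2 *: V 1 2).
  apply/funext => y; rewrite /hamiltonian potentialE.
  congr (_ - _); rewrite fct_sumE; apply: eq_bigr => i _.
  by rewrite enorm_sqr.
have dV i j : row i z.1 - row j z.1 != 0 -> differentiable (V i j) z.
  move=> ij; apply: differentiable_inv_enorm => // k.
  have -> : (fun y : phase R => (row i y.1 - row j y.1) 0 k : R^o) =
     (fun y : phase R => y.1 i k : R^o) - (fun y : phase R => y.1 j k : R^o).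
    by apply/funext => y; rewrite !mxE.
  by apply: differentiableB; exact: differentiable_q.
apply: differentiableB.
  apply: differentiable_sum => i; apply: differentiableZ.
  by apply: differentiable_dot => k; under eq_fun do rewrite mxE; exact: differentiable_p.
apply: differentiableD; first apply: differentiableD.
all: by apply: differentiableZ; exact: dV.
Qed.

Lemma differentiable_angular_momentum z :
  differentiable (@angular_momentum R : phase R -> 'rV[R]_3) z.
Proof.
have -> : (@angular_momentum R : phase R -> 'rV[R]_3) =
   \sum_(i < 3) (fun z => cross (row i z.1) (row i z.2)).
  by apply/funext => y; rewrite fct_sumE.
apply: differentiable_sum => i; apply: differentiable_row => k.
have -> : (fun y : phase R => cross (row i y.1) (row i y.2) 0 k : R^o) =
  (fun y : phase R => y.1 i (k + 1) : R^o) * (fun y : phase R => y.2 i (k + 2) : R^o) -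
  (fun y : phase R => y.1 i (k + 2) : R^o) * (fun y : phase R => y.2 i (k + 1) : R^o).
  by apply/funext => y; rewrite !mxE.
by apply: differentiableB; apply: differentiableM;
  [exact: differentiable_q|exact: differentiable_p|exact: differentiable_q|exact: differentiable_p].
Qed.

(** Needed because ['d] is meaningful only at points of differentiability; off the collisions the
    inverse distances are differentiable. *)
Lemma differentiable_integral_map m g z : configuration z.1 ->
  differentiable (integral_map m g) z.
Proof.
move=> cz; apply: differentiable_pair; first apply: differentiable_pair;
  first apply: differentiable_pair.
- exact: differentiable_hamiltonian.
- exact: differentiable_angular_momentum.
- apply: differentiable_row => k.
  have -> : (fun y : phase R => total_momentum y.2 0 k : R^o) =
     \sum_(i < 3) (fun y : phase R => y.2 i k : R^o).
    apply/funext => y; rewrite fct_sumE /total_momentum summxE.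
    by apply: eq_bigr => i _; rewrite mxE.
  by apply: differentiable_sum => i; exact: differentiable_p.
- apply: differentiable_row => k.
  have -> : (fun y : phase R => center_of_mass m y.1 0 k : R^o) =
     (\sum_(i < 3) m i)^-1 *: \sum_(i < 3) (m i *: (fun y : phase R => y.1 i k : R^o)).
    apply/funext => y; rewrite /center_of_mass mxE summxE.
    congr (_ * _); rewrite fct_sumE; apply: eq_bigr => i _.
    by rewrite !mxE.
  by apply: differentiableZ; apply: differentiable_sum => i; apply: differentiableZ;
    exact: differentiable_q.
Qed.

(** The covector of Lagrange multipliers: composed with the integral map it is the augmented
    Hamiltonian of the frame rotating with angular velocity [e]. *)
Definition integral_form e (y : R^o * 'rV[R]_3 * 'rV[R]_3 * 'rV[R]_3) : R^o :=
  y.1.1.1 - dot e y.1.1.2.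

Fact integral_form_linear e : linear (integral_form e).
Proof.
by move=> a x y; rewrite /integral_form /= dotDr dotZr /GRing.scale /=; ring.
Qed.

HB.instance Definition _ e :=
  GRing.isLinear.Build R _ _ _ (integral_form e) (integral_form_linear e).

Lemma differentiable_integral_form e x : differentiable (integral_form e) x.
Proof.
pose T1 : normedModType R := (R^o * 'rV[R]_3)%type.
pose T2 : normedModType R := (T1 * 'rV[R]_3)%type.
have d2 : differentiable (fst \o fst : T2 * 'rV[R]_3 -> T1) x.
  by apply: differentiable_comp; exact: differentiable_fst.
apply: differentiableB.
  apply: (@differentiable_comp _ _ _ _ (fst \o fst : T2 * 'rV[R]_3 -> T1) fst) => //.
  exact: differentiable_fst.
apply: differentiable_dot => k //.
apply: (@differentiable_comp _ _ _ _ (fst \o fst : T2 * 'rV[R]_3 -> T1) (fun y => y.2 0 k : R^o)) => //.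
apply: (@differentiable_comp _ _ _ _ snd (fun M : 'rV[R]_3 => M 0 k : R^o)).
  exact: differentiable_snd.
exact: differentiable_coord.
Qed.

(** By the chain rule the image of the differential lies in the kernel of [integral_form e]. This
    kernel is a proper subspace of a space of dimension 1 + 3 + 3 + 3, since the functional is 1 on
    the energy direction. *)
Lemma critical_point_integral_form m g z e : configuration z.1 ->
  (forall v, 'D_v (integral_form e \o integral_map m g) z = 0) ->
  critical_point m g z.
Proof.
move=> cz D0; split => //.
have dF := differentiable_integral_map m g cz.
have dphi v : integral_form e ('d (integral_map m g) z v) = 0.
  have dform := differentiable_integral_form e (integral_map m g z).
  have := D0 v; rewrite deriveE; last exact: differentiable_comp.
  rewrite diff_comp//= diff_lin//.
  by move=> y; apply: differentiable_continuous; exact: differentiable_integral_form.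
have sub : (limg (linfun ('d (integral_map m g) z)) <= lker (linfun (integral_form e)))%VS.
  by apply/subvP => _ /memv_imgP[v _ ->]; rewrite memv_ker lfunE /= lfunE /= dphi.
apply: (leq_ltn_trans (dimvS sub)).
pose T : vectType R := (R^o * 'rV[R]_3 * 'rV[R]_3 * 'rV[R]_3)%type.
have D : \dim (@fullv R T) = 10%N by rewrite dimvf.
rewrite -D ltnNge; apply/negP => le10.
have /eqP E : lker (linfun (integral_form e)) == fullv by rewrite eqEdim subvf.
have : ((1 : R^o), 0, 0, 0) \in lker (linfun (integral_form e)) by rewrite E memvf.
rewrite memv_ker lfunE /= /integral_form /= dotC dot0l subr0.
by rewrite oner_eq0.
Qed.

(* H - <e, L> is stationary at a relative equilibrium of angular velocity e. *)
Lemma critical_relative_equilibrium m g z lambda e :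
  (forall i, 0 < m i) -> center_of_mass m z.1 = 0 ->
  central_configuration m g z.1 lambda ->
  (forall i, dot e (row i z.1) = 0) -> dot e e = lambda ->
  (forall i, row i z.2 = m i *: cross e (row i z.1)) ->
  critical_point m g z.
Proof.
move=> m0 Q0 cc eq ee pE.
have [cz [E0 E1 E2]] := (central_configurationP m g z.1 lambda).1 cc.
apply: (@critical_point_integral_form m g z e cz) => v.
rewrite derive_line.
(* Along a line through [z] the augmented Hamiltonian without its potential is exactly A + h B + h^2
   C, so only [B] enters the derivative at 0. *)
pose A := \sum_(i < 3) ((2 * m i)^-1 * dot (row i z.2) (row i z.2)
  - dot e (cross (row i z.1) (row i z.2))).
pose B := \sum_(i < 3) ((m i)^-1 * dot (row i z.2) (row i v.2)
  - dot e (cross (row i v.1) (row i z.2)) - dot e (cross (row i z.1) (row i v.2))).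
pose C := \sum_(i < 3) ((2 * m i)^-1 * dot (row i v.2) (row i v.2)
  - dot e (cross (row i v.1) (row i v.2))).
have -> : (fun h : R => (integral_form e \o integral_map m g) (h *: v + z)) =
   (fun h : R => A + h * B + h ^+ 2 * C) + (fun h : R => potential g (h *: v.1 + z.1)).
  apply/funext => h; rewrite !fctE /integral_form /= /hamiltonian /angular_momentum /=.
  rewrite addrAC; congr (_ + _); rewrite /A /B /C !sum3E !enorm_sqr !linearD !linearZ /=.
  rewrite !dot_line !(crossDl, crossDr, crossZl, crossZr, dotDr, dotZr).
  by field; rewrite !gt_eqF.
have dP := is_derive_potential_line g v.1 cz.
rewrite (@derive_val _ _ _ _ _ _ _ (is_deriveD (is_derive_quadratic A B C) dP)).
(* The variations of momenta cancel because p_i = m_i e x q_i. For those of positions the double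
   cross product gives <e, e> q_i, as e is orthogonal to q_i; the central configuration equations
   then cancel this against the derivative of the potential. *)
have BE : B = - \sum_(i < 3) (dot ((lambda * m i) *: (row i z.1 - center_of_mass m z.1)) (row i v.1)).
  rewrite -sumrN; apply: eq_bigr => i _; rewrite pE Q0 subr0.
  rewrite !dot_crossA dotZl mulKf ?gt_eqF//.
  rewrite [cross e (row i v.1)]crossC dotNl dotZr -[dot (cross (row i v.1) e) _]dot_crossA.
  rewrite [cross e (cross _ _)]crossC (cross_cross (eq i)) ee dotNr !dotZr dotZl.
  by rewrite (dotC (row i v.1)); ring.
rewrite BE sum3E E0 E1 E2 /potential_diff !(dotDl, dotNl, dotDr, dotNr, dotZl).
by ring.
Qed.

End Critical.

(** * Collinear central configurations *)

Section Collinear.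
Context {R : realType}.
Implicit Types (m : 'I_3 -> R) (g : 'I_3 -> 'I_3 -> R) (q : 'M[R]_3) (x Lam : R).

(** Writing the shape as a quotient of scalar products defines it for every [q] and makes its
    invariance under similarities immediate. *)
Definition line_ratio q : R :=
  dot (row 1 q - row 0 q) (row 2 q - row 0 q) / dot (row 2 q - row 0 q) (row 2 q - row 0 q).

Lemma collinear_ratio q : configuration q -> collinear q ->
  [/\ row 1 q - row 0 q = line_ratio q *: (row 2 q - row 0 q), row 2 q - row 0 q != 0,
      line_ratio q != 0 & line_ratio q != 1].
Proof.
move=> cq [a [d [d0 qE]]].
have q20 : row 2 q - row 0 q != 0 by rewrite subr_eq0 cq.
have E : row 1 q - row 0 q = line_ratio q *: (row 2 q - row 0 q).
  move: q20; rewrite /line_ratio.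
  have [t0 ->] := qE 0; have [t1 ->] := qE 1; have [t2 ->] := qE 2.
  have dE s t : a + s *: d - (a + t *: d) = (s - t) *: d.
    by rewrite opprD addrACA subrr add0r scalerBl.
  rewrite !dE !dotZl !dotZr scaler_eq0 (negbTE d0) orbF => t20.
  rewrite scalerA; congr (_ *: _); field.
  by apply/andP; rewrite dot_eq0 d0.
split => //.
  by apply: contra_neq (cq 1 0 isT) => x0; apply/eqP; rewrite -subr_eq0 E x0 scale0r.
apply: contra_neq (cq 1 2 isT) => x1; apply: (addIr (- row 0 q)).
by rewrite E x1 scale1r.
Qed.

Lemma similar_sub q q' (a : R) (A : 'M[R]_3) (c : 'rV[R]_3) i j :
  (forall i : 'I_3, row i q' = a *: (row i q *m A) + c) ->
  row i q' - row j q' = a *: ((row i q - row j q) *m A).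
Proof.
move=> E; by rewrite !E opprD addrACA subrr addr0 -scalerBr -mulmxBl.
Qed.

Lemma similar_ratio q q' : Defs.similar q q' -> line_ratio q = line_ratio q'.
Proof.
move=> [a [A [c [a0 AA _ E]]]]; rewrite /line_ratio !(similar_sub _ _ E).
rewrite !dotZl !dotZr !(dot_orthogonal _ _ AA) !mulrA -!expr2 invfM.
by rewrite mulrACA divff ?mul1r// expf_neq0// gt_eqF.
Qed.

Lemma similar_from_sides q q' (a : R) (A : 'M[R]_3) :
  0 < a -> A *m A^T = 1%:M -> \det A = 1 ->
  row 1 q' - row 0 q' = a *: ((row 1 q - row 0 q) *m A) ->
  row 2 q' - row 0 q' = a *: ((row 2 q - row 0 q) *m A) -> Defs.similar q q'.
Proof.
move=> a0 AA dA h1 h2; exists a, A, (row 0 q' - a *: (row 0 q *m A)); split => //.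
have key i : row i q' - row 0 q' = a *: ((row i q - row 0 q) *m A) ->
    row i q' = a *: (row i q *m A) + (row 0 q' - a *: (row 0 q *m A)).
  by move=> h; rewrite addrCA -scalerBr -mulmxBl -h addrC subrK.
by apply: forall3; apply: key => //; rewrite !subrr mul0mx scaler0.
Qed.

(** Rotations of space carry any direction to any other, including its opposite, so a positive
    dilation and a rotation match the sides from body 0 to body 2; the ratio then matches body 1. *)
Lemma ratio_similar q q' : configuration q -> collinear q ->
  configuration q' -> collinear q' -> line_ratio q = line_ratio q' -> Defs.similar q q'.
Proof.
move=> cq lq cq' lq' qq'.
have [E w0 _ _] := collinear_ratio cq lq.
have [E' w'0 _ _] := collinear_ratio cq' lq'.
set w := row 2 q - row 0 q in E w0; set w' := row 2 q' - row 0 q' in E' w'0.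
pose a := enorm w' / enorm w.
have a0 : 0 < a by rewrite divr_gt0 ?enorm_gt0.
have [|A [AA dA wA]] := @exists_rotation1 _ w (a^-1 *: w') w0.
  rewrite dotZl dotZr -!enorm_sqr /a; field.
  by rewrite !gt_eqF ?enorm_gt0.
have wa : w' = a *: (w *m A) by rewrite wA scalerA divff ?scale1r// gt_eqF.
apply: (similar_from_sides a0 AA dA); last exact: wa.
by rewrite E E' -qq' wa -!scalemxAl !scalerA mulrC.
Qed.

(** Bodies 0, 1, 2 sit at 0, x, 1, and the equations for bodies 1 and 2 are taken relative to body
    0. The signed forces x / |x|^3 treat all three orders at once. *)
Definition line_cc m g x Lam : Prop :=
  [/\ x != 0, x != 1,
    Lam * x = (g 0 1 * (x / `|x| ^+ 3) + g 1 2 * ((x - 1) / `|x - 1| ^+ 3)) / m 1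
      + (g 0 1 * (x / `|x| ^+ 3) + g 0 2) / m 0 &
    Lam = (g 0 2 - g 1 2 * ((x - 1) / `|x - 1| ^+ 3)) / m 2
      + (g 0 1 * (x / `|x| ^+ 3) + g 0 2) / m 0].

Lemma line_cc_ratio m g q lambda : (forall i, 0 < m i) -> 0 < lambda ->
  central_configuration m g q lambda -> collinear q ->
  exists2 Lam, 0 < Lam & line_cc m g (line_ratio q) Lam.
Proof.
move=> m0 l0 /central_configurationP[cq [E0 E1 E2]] lq.
have [E w0 x0 x1] := collinear_ratio cq lq.
set x := line_ratio q in E x0 x1 *; set w := row 2 q - row 0 q in E w0.
have r01 : row 0 q - row 1 q = (- x) *: w by rewrite -opprB E scaleNr.
have r02 : row 0 q - row 2 q = (- 1) *: w by rewrite -opprB scaleN1r.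
have r12 : row 1 q - row 2 q = (x - 1) *: w.
  by rewrite -(subrK (row 0 q) (row 1 q)) E -addrA r02 -scalerDl.
have W0 : 0 < enorm w by rewrite enorm_gt0.
(* Normalizing the side from body 0 to body 2 to length 1 multiplies the multiplier by the cube of
   that length. *)
exists (lambda * enorm w ^+ 3); first by rewrite mulr_gt0// exprn_gt0.
rewrite r01 r02 r12 !enormZ !normrN normr1 mul1r in E0 E1 E2.
have nx0 : `|x| != 0 by rewrite normr_eq0.
have nx1 : `|x - 1| != 0 by rewrite normr_eq0 subr_eq0.
have [m0n m1n m2n] : [/\ m 0 != 0, m 1 != 0 & m 2 != 0] by rewrite !gt_eqF.
(* All vectors involved are multiples of [w], so one coordinate in which [w] is nonzero carries the
   whole information. *)
have [k wk] : exists k, w 0 k != 0.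
  apply/existsP; apply: contraNT w0 => /existsPn h; apply/eqP/rowP => k.
  by have := h k; rewrite negbK => /eqP ->; rewrite [in RHS]mxE.
clearbody x; clearbody w; move: (center_of_mass m q) E0 E1 E2 => Q.
move=> /rowP/(_ k) E0 /rowP/(_ k) E1 /rowP/(_ k) E2; move/rowP/(_ k): E => E.
have rE i j : (row i q - row j q) 0 k = row i q 0 k - row j q 0 k by rewrite !mxE.
move/rowP/(_ k): r02; rewrite rE => r02; rewrite rE in E.
rewrite !mxE in E r02 E0 E1 E2.
have D i r : lambda * m i * (q i k - Q 0 k) = r -> lambda * (q i k - Q 0 k) = r / m i.
  by move=> <-; field; rewrite gt_eqF.
move/D: E0 => D0; move/D: E1 => D1; move/D: E2 => D2.
split => //; apply: (mulIf wk).
  transitivity (enorm w ^+ 3 * (lambda * (q 1 k - Q 0 k) - lambda * (q 0 k - Q 0 k))).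
    by rewrite -mulrBr opprB addrA subrK E; ring.
  by rewrite D0 D1; field; rewrite ?nx0 ?nx1 ?m0n ?m1n ?(gt_eqF W0).
transitivity (enorm w ^+ 3 * (lambda * (q 2 k - Q 0 k) - lambda * (q 0 k - Q 0 k))).
  rewrite -mulrBr opprB addrA subrK -[q 2 k - q 0 k]opprB r02; ring.
by rewrite D0 D2; field; rewrite ?nx0 ?nx1 ?m0n ?m2n ?(gt_eqF W0).
Qed.

(** The sign of x and its comparison with 1 select the middle body. Since [ordered_cc] has first gap
    1, [Lam] is multiplied by the cube of the first gap, which is -x, x or 1. *)
Lemma line_cc_shapes m g x Lam : (forall i, 0 < m i) -> 0 < Lam -> line_cc m g x Lam ->
  shapes (m 0) (m 1) (m 2) (g 0 1) (g 0 2) (g 1 2) x.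
Proof.
move=> m0 L0 [x0 x1 E1 E2].
have [m0n m1n m2n] : [/\ m 0 != 0, m 1 != 0 & m 2 != 0] by rewrite !gt_eqF.
have xm1 : x - 1 != 0 by rewrite subr_eq0.
have xm1' : 1 - x != 0 by rewrite -opprB oppr_eq0.
have [xs xs'] : x + (1 - x) != 0 /\ 1 + (x - 1) != 0.
  by split; [rewrite addrCA subrr addr0 oner_eq0|rewrite addrCA subrr addr0].
have [xn|xp|xE] := ltgtP x 0; last by rewrite xE eqxx in x0.
  right; split => //; exists (Lam * (- x) ^+ 3).
    by rewrite mulr_gt0// exprn_gt0// oppr_gt0.
  rewrite (ltr0_norm xn) ltr0_norm ?subr_lt0 ?(lt_trans xn)// in E1 E2.
  split; first by rewrite oppr_gt0 invr_lt0.
    have -> : Lam * (- x) ^+ 3 = x ^+ 2 * (- (Lam * x)) by ring.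
    rewrite E1; field; do ?[apply/andP; split=> //].
  have -> : - x^-1 * (Lam * (- x) ^+ 3) = x ^+ 2 * Lam by field.
  rewrite E2; field; do ?[apply/andP; split=> //].
left; have [x1n|x1p|xE] := ltgtP x 1; last by rewrite xE eqxx in x1.
  left; split => //; exists (Lam * x ^+ 3); first by rewrite mulr_gt0// exprn_gt0.
  rewrite (gtr0_norm xp) ltr0_norm ?subr_lt0// in E1 E2.
  split; first by rewrite divr_gt0 ?subr_gt0.
    have -> : Lam * x ^+ 3 = x ^+ 2 * (Lam * x) by ring.
    rewrite E1; field; do ?[apply/andP; split=> //].
  have -> : (1 - x) / x * (Lam * x ^+ 3) = x ^+ 2 * (Lam - Lam * x) by field.
  rewrite E1 [X in X - _]E2; field; do ?[apply/andP; split=> //].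
right; split => //; exists Lam => //.
rewrite (gtr0_norm xp) gtr0_norm ?subr_gt0// in E1 E2.
split; first by rewrite subr_gt0.
  rewrite E2; field; do ?[apply/andP; split=> //].
have -> : (x - 1) * Lam = Lam * x - Lam by ring.
rewrite E1 E2; field; do ?[apply/andP; split=> //].
Qed.

Lemma shapes_line_cc m g x : (forall i, 0 < m i) ->
  shapes (m 0) (m 1) (m 2) (g 0 1) (g 0 2) (g 1 2) x ->
  exists2 Lam, 0 < Lam & line_cc m g x Lam.
Proof.
move=> m0; have [m0n m1n m2n] : [/\ m 0 != 0, m 1 != 0 & m 2 != 0] by rewrite !gt_eqF.
case=> [[|]|].
- move=> [x0 x1 [lam l0 [t0 E1 E2]]].
  have x0n : x != 0 by rewrite gt_eqF.
  have xm1' : 1 - x != 0 by rewrite subr_eq0 gt_eqF.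
  have xm1 : x - 1 != 0 by rewrite subr_eq0 lt_eqF.
  have xs : x + (1 - x) != 0 by rewrite addrCA subrr addr0 oner_eq0.
  exists (lam / x ^+ 3); first by rewrite divr_gt0// exprn_gt0.
  rewrite /line_cc (gtr0_norm x0) ltr0_norm ?subr_lt0// x0n lt_eqF//.
  split => //.
    have -> : lam / x ^+ 3 * x = lam / x ^+ 2 by field.
    rewrite E1; field; do ?[apply/andP; split=> //].
  have -> : lam / x ^+ 3 = (lam + (1 - x) / x * lam) / x ^+ 2 by field.
  rewrite [in X in _ + X]E2 E1; field; do ?[apply/andP; split=> //].
- move=> [x1 [lam l0 [t0 E1 E2]]].
  have x0 : 0 < x by rewrite (lt_trans _ x1).
  have xm1 : x - 1 != 0 by rewrite gt_eqF.
  have x0n : x != 0 by rewrite gt_eqF.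
  exists lam => //.
  rewrite /line_cc (gtr0_norm x0) gtr0_norm// x0n gt_eqF//.
  split => //.
    have -> : lam * x = lam + (x - 1) * lam by ring.
    rewrite E2 E1; field; do ?[apply/andP; split=> //].
  rewrite E1; field; do ?[apply/andP; split=> //].
- move=> [x0 [lam l0 [t0 E1 E2]]].
  have x0n : x != 0 by rewrite lt_eqF.
  have x1 : x < 1 by rewrite (lt_trans x0).
  have xm1' : 1 - x != 0 by rewrite subr_eq0 gt_eqF.
  have xm1 : x - 1 != 0 by rewrite subr_eq0 lt_eqF.
  have xs : x + (1 - x) != 0 by rewrite addrCA subrr addr0 oner_eq0.
  exists (lam / (- x) ^+ 3); first by rewrite divr_gt0// exprn_gt0// oppr_gt0.
  rewrite /line_cc (ltr0_norm x0) ltr0_norm ?subr_lt0// x0n lt_eqF//.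
  split => //.
    have -> : lam / (- x) ^+ 3 * x = - lam / x ^+ 2 by field.
    rewrite E1; field; do ?[apply/andP; split=> //].
  have -> : lam / (- x) ^+ 3 = - x^-1 * lam / x ^+ 2 by field.
  rewrite E2; field; do ?[apply/andP; split=> //].
Qed.

End Collinear.

(** * From shapes on a line to similarity classes of critical points *)

Section Classes.
Context {R : realType}.
Implicit Types (m : 'I_3 -> R) (g : 'I_3 -> 'I_3 -> R) (q : 'M[R]_3) (x Lam : R).

Lemma line_cc_realized m g x Lam : (forall i, 0 < m i) -> 0 < Lam ->
  line_cc m g x Lam ->
  exists2 z, collinear_critical_point m g z & line_ratio z.1 = x.
Proof.
move=> m0 L0 [x0 x1 E1 E2].
have [m0n m1n m2n] : [/\ m 0 != 0, m 1 != 0 & m 2 != 0] by rewrite !gt_eqF.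
have M0 : m 0 + m 1 + m 2 != 0 by rewrite gt_eqF// !addr_gt0.
(* The position of body 0 for which the center of mass of [s0], [s0 + x], [s0 + 1] is the origin.
   The line is the first axis and the angular velocity lies on the third. *)
pose s0 := - ((m 1 * x + m 2) / (m 0 + m 1 + m 2)).
pose s (i : 'I_3) : R := if i == 0 then s0 else if i == 1 then s0 + x else s0 + 1.
pose d : 'rV[R]_3 := delta_mx 0 0.
pose e : 'rV[R]_3 := Num.sqrt Lam *: delta_mx 0 2.
pose q : 'M[R]_3 := \matrix_(i < 3) (s i *: d).
pose p : 'M[R]_3 := \matrix_(i < 3) (m i *: cross e (s i *: d)).
have rq i : row i q = s i *: d by rewrite rowK.
have rp i : row i p = m i *: cross e (row i q) by rewrite rowK rq.
have dd : dot d d = 1 by rewrite dotE !mxE /=; ring.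
have nd : enorm d = 1 by rewrite /enorm dd sqrtr1.
have d0 : d != 0 by rewrite -dot_eq0 dd oner_eq0.
have ed : dot e d = 0 by rewrite dotE !mxE /=; ring.
have ee : dot e e = Lam.
  rewrite dotZl dotZr mulrA -expr2 sqr_sqrtr ?(ltW L0)//.
  by rewrite dotE !mxE /=; ring.
have sms : m 0 * s 0 + m 1 * s 1 + m 2 * s 2 = 0.
  by rewrite /s /= /s0; field.
have com : center_of_mass m q = 0.
  rewrite /center_of_mass !sum3E !rq !scalerA -!scalerDl sms.
  by rewrite scale0r scaler0.
have r01 : row 0 q - row 1 q = (- x) *: d.
  by rewrite !rq -scalerBl; congr (_ *: _); rewrite /s /=; ring.
have r02 : row 0 q - row 2 q = (- 1) *: d.
  by rewrite !rq -scalerBl; congr (_ *: _); rewrite /s /=; ring.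
have r12 : row 1 q - row 2 q = (x - 1) *: d.
  by rewrite !rq -scalerBl; congr (_ *: _); rewrite /s /=; ring.
have cq : configuration q.
  apply/configurationP; rewrite r01 r02 r12 !scaler_eq0 (negbTE d0) !orbF.
  by rewrite !oppr_eq0 subr_eq0 oner_eq0.
have nx0 : `|x| != 0 by rewrite normr_eq0.
have nx1 : `|x - 1| != 0 by rewrite normr_eq0 subr_eq0.
(* The relative equations omit the one for body 0. It is recovered from the mass-weighted sum, in
   which the internal forces cancel. *)
have s0E : Lam * s0 = - (g 0 1 * (x / `|x| ^+ 3) + g 0 2) / m 0.
  rewrite /s0.
  transitivity (- ((m 1 * (Lam * x) + m 2 * Lam) / (m 0 + m 1 + m 2))); first by field.
  by rewrite E1 [X in _ + m 2 * X]E2; field; do ?[apply/andP; split=> //].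
have cc : central_configuration m g q Lam.
  apply/central_configurationP; split => //.
  rewrite com !subr0 r01 r02 r12 !rq !enormZ !normrN normr1 nd !mulr1 expr1n !divr1.
  rewrite !scalerA -!(scaleNr _ d) -!scalerDl.
  split; congr (_ *: _).
  - transitivity (m 0 * (Lam * s0)); first by rewrite /s /=; ring.
    by rewrite s0E; field; do ?[apply/andP; split=> //].
  - transitivity (m 1 * (Lam * s0 + Lam * x)); first by rewrite /s /=; ring.
    by rewrite s0E E1; field; do ?[apply/andP; split=> //].
  - transitivity (m 2 * (Lam * s0 + Lam)); first by rewrite /s /=; ring.
    by rewrite s0E E2; field; do ?[apply/andP; split=> //].
have eq i : dot e (row i q) = 0 by rewrite rq dotZr ed mulr0.
exists (q, p); last first.
  rewrite /line_ratio /= -(opprB (row 0 q) (row 1 q)) -(opprB (row 0 q)) r01 r02.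
  by rewrite !(dotNl, dotNr, dotZl, dotZr) dd; field.
split; last first.
  exists 0, d; split => // i; exists (s i).
  by rewrite rq add0r.
split => //=.
- exact: (@critical_relative_equilibrium R m g (q, p) Lam e m0 com cc).
- rewrite /total_momentum sum3E !rp !rq !crossZr !scalerA -!scalerDl sms.
  by rewrite scale0r.
- by exists Lam, e; split.
Qed.

Lemma collinear_critical_ratios m g : (forall i, 0 < m i) ->
  (fun z : phase R => line_ratio z.1) @` collinear_critical_point m g =
  shapes (m 0) (m 1) (m 2) (g 0 1) (g 0 2) (g 1 2).
Proof.
move=> m0; apply/seteqP; split => [_ [z [[_ _ _ [lam [e [l0 cc _ _ _]]]] lz] <-]|x].
  have [Lam L0 lcc] := line_cc_ratio m0 l0 cc lz.
  exact: line_cc_shapes lcc.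
by move=> /(shapes_line_cc m0)[Lam L0 /(line_cc_realized m0 L0)[z Sz <-]]; exists z.
Qed.

(** If [r] is a complete invariant on [S], the classes are its nonempty fibres, and a fibre
    determines the value of [r]. *)
Lemma card_similarity_classes (S : set (phase R)) (T : Type) (r : phase R -> T) :
  (forall z w, S z -> S w -> Defs.similar z.1 w.1 <-> r z = r w) ->
  (similarity_classes S #= r @` S)%card.
Proof.
move=> Sr; pose G (x : T) := [set w | S w /\ x = r w].
have -> : similarity_classes S = G @` (r @` S).
  rewrite image_comp; apply/seteqP; split => [C [z Sz ->]|_ [z Sz <-]]; exists z => //;
    by apply/seteqP; split => w [Sw h]; split => //; exact/(Sr z w Sz Sw).
apply: inj_card_eq => _ _ /set_mem[z Sz <-] /set_mem[w Sw <-] E.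
have : G (r w) z by rewrite -E.
by case=> _ ->.
Qed.

Lemma card_collinear_classes m g : (forall i, 0 < m i) ->
  (similarity_classes (collinear_critical_point m g) #=
   shapes (m 0) (m 1) (m 2) (g 0 1) (g 0 2) (g 1 2))%card.
Proof.
move=> m0; rewrite -collinear_critical_ratios//.
apply: card_similarity_classes => z w [[[cz _] _ _ _] lz] [[[cw _] _ _ _] lw].
split; first exact: similar_ratio.
exact: ratio_similar.
Qed.

End Classes.

(** * Non-collinear central configurations *)

Section NonCollinear.
Context {R : realType}.
Implicit Types (m : 'I_3 -> R) (g : 'I_3 -> 'I_3 -> R) (q : 'M[R]_3).

(** Equality case of Cauchy-Schwarz: the difference of the two sides has squared norm [dot v v]
    times the Gram determinant. *)
Lemma gram_dependent (u v : 'rV[R]_3) :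
  dot u u * dot v v - dot u v ^+ 2 = 0 -> dot v v *: u = dot u v *: v.
Proof.
move=> D0; apply/eqP; rewrite -subr_eq0 -dot_eq0.
rewrite !(dotDl, dotDr, dotNl, dotNr, dotZl, dotZr) (dotC v u); apply/eqP.
by transitivity (dot v v * (dot u u * dot v v - dot u v ^+ 2)); [ring|rewrite D0 mulr0].
Qed.

Lemma dot_sub (u v : 'rV[R]_3) :
  dot (u - v) (u - v) = dot u u - 2 * dot u v + dot v v.
Proof. by rewrite !(dotDl, dotDr, dotNl, dotNr) (dotC v u); ring. Qed.

Lemma noncollinear_gram q : configuration q -> ~ collinear q ->
  dot (row 1 q - row 0 q) (row 1 q - row 0 q) * dot (row 2 q - row 0 q) (row 2 q - row 0 q)
  - dot (row 1 q - row 0 q) (row 2 q - row 0 q) ^+ 2 != 0.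
Proof.
move=> cq nl; apply/negP => /eqP D0; apply: nl.
set u := row 1 q - row 0 q in D0; set v := row 2 q - row 0 q in D0.
have v0 : v != 0 by rewrite subr_eq0 cq.
have vv0 : dot v v != 0 by rewrite dot_eq0.
have E := gram_dependent D0.
exists (row 0 q), v; split => //; apply: forall3.
- by exists 0; rewrite scale0r addr0.
- exists (dot u v / dot v v); rewrite mulrC -scalerA -E scalerA mulVf// scale1r.
  by rewrite addrC subrK.
- by exists 1; rewrite scale1r addrC subrK.
Qed.

Lemma gram_free (u v : 'rV[R]_3) (a b c d : R) :
  dot u u * dot v v - dot u v ^+ 2 != 0 -> a *: u + b *: v = c *: u + d *: v ->
  a = c /\ b = d.
Proof.
move=> D0 E.
have h w : (a - c) * dot u w + (b - d) * dot v w = 0.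
  rewrite -!dotZl -dotDl !scalerBl addrACA E -opprD subrr.
  by rewrite dot0l.
have hu := h u; have hv := h v; rewrite (dotC v u) in hu.
split; apply/eqP; rewrite -subr_eq0; apply: contraTT D0 => ne; rewrite negbK.
  apply/eqP; apply: (mulfI ne); rewrite mulr0.
  transitivity (dot v v * ((a - c) * dot u u + (b - d) * dot u v)
    - dot u v * ((a - c) * dot u v + (b - d) * dot v v)); first by ring.
  by rewrite hu hv !mulr0 subr0.
apply/eqP; apply: (mulfI ne); rewrite mulr0.
transitivity (dot u u * ((a - c) * dot u v + (b - d) * dot v v)
    - dot u v * ((a - c) * dot u u + (b - d) * dot u v)); first by ring.
by rewrite hu hv !mulr0 subr0.
Qed.

(* Lagrange: the triangle is equilateral in the metric where the side i j is
   rescaled by (m i m j / g i j)^(1/3). *)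
Lemma noncollinear_sides m g q lambda : (forall i, 0 < m i) ->
  central_configuration m g q lambda -> ~ collinear q ->
  let M := m 0 + m 1 + m 2 in
  [/\ g 0 1 * M = lambda * (m 0 * m 1) * enorm (row 1 q - row 0 q) ^+ 3,
      g 0 2 * M = lambda * (m 0 * m 2) * enorm (row 2 q - row 0 q) ^+ 3 &
      g 1 2 * M = lambda * (m 1 * m 2) * enorm (row 1 q - row 2 q) ^+ 3].
Proof.
move=> m0 /central_configurationP[cq [E0 E1 _]] nl M.
have M0 : M != 0 by rewrite gt_eqF// !addr_gt0.
have D0 := noncollinear_gram cq nl.
have [m0n m1n m2n] : [/\ m 0 != 0, m 1 != 0 & m 2 != 0] by rewrite !gt_eqF.
have [r01 r02 r12] := (configurationP q).1 cq.
rewrite -enorm_gt0 in r01; rewrite -enorm_gt0 in r02; rewrite -enorm_gt0 in r12.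
have e10 : enorm (row 1 q - row 0 q) = enorm (row 0 q - row 1 q) by rewrite -enormN opprB.
have e20 : enorm (row 2 q - row 0 q) = enorm (row 0 q - row 2 q) by rewrite -enormN opprB.
rewrite e10 e20; clear e10 e20.
set u := row 1 q - row 0 q in D0; set v := row 2 q - row 0 q in D0.
have uE : row 0 q - row 1 q = - u by rewrite opprB.
have vE : row 0 q - row 2 q = - v by rewrite opprB.
have uvE : row 1 q - row 2 q = u - v by rewrite opprB addrA subrK.
have Q0 : row 0 q - center_of_mass m q = - ((m 1 / M) *: u + (m 2 / M) *: v).
  have -> : row 0 q = M^-1 *: (M *: row 0 q) by rewrite scalerA mulVf// scale1r.
  rewrite /center_of_mass !sum3E -/M -scalerBr.
  rewrite ![_ / M]mulrC -!scalerA -scalerDr -scalerN; congr (_ *: _).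
  by apply/rowP => k; rewrite !mxE /M; ring.
have Q1 : row 1 q - center_of_mass m q = u - ((m 1 / M) *: u + (m 2 / M) *: v).
  by rewrite -Q0 addrA subrK.
move: E0 E1; rewrite Q0 Q1.
set c01 := g 0 1 / _; set c02 := g 0 2 / _; set c12 := g 1 2 / _.
move=> E0 E1; rewrite uE vE in E0; rewrite uE uvE in E1.
(* The sides u and v are independent, so coefficients can be compared: each gamma_ij / r_ij^3 equals
   lambda m_i m_j / M. *)
have [h01 h02] : c01 = lambda * m 0 * (m 1 / M) /\ c02 = lambda * m 0 * (m 2 / M).
  apply: (gram_free D0); apply: oppr_inj.
  by rewrite opprD -!scalerN -E0 scalerN scalerDr !scalerA.
have [_ h12] : c01 + c12 = lambda * m 1 * (1 - m 1 / M) /\ - c12 = - (lambda * m 1 * (m 2 / M)).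
  apply: (gram_free D0); move: E1.
  rewrite scalerN opprK [c12 *: _]scalerBr addrA -scalerDl scaleNr => <-.
  by apply/rowP => k; rewrite !mxE; ring.
move/oppr_inj in h12.
split.
- transitivity (c01 * M * enorm (row 0 q - row 1 q) ^+ 3).
    by rewrite /c01; field; rewrite gt_eqF.
  by rewrite h01; field.
- transitivity (c02 * M * enorm (row 0 q - row 2 q) ^+ 3).
    by rewrite /c02; field; rewrite gt_eqF.
  by rewrite h02; field.
- transitivity (c12 * M * enorm (row 1 q - row 2 q) ^+ 3).
    by rewrite /c12; field; rewrite gt_eqF.
  by rewrite h12; field.
Qed.

Lemma noncollinear_similar m g q q' lambda lambda' : (forall i, 0 < m i) ->
  0 < lambda -> 0 < lambda' ->
  central_configuration m g q lambda -> ~ collinear q ->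
  central_configuration m g q' lambda' -> ~ collinear q' -> Defs.similar q q'.
Proof.
move=> m0 l0 l0' cc nl cc' nl'.
have [h01 h02 h12] := noncollinear_sides m0 cc nl.
have [h01' h02' h12'] := noncollinear_sides m0 cc' nl'.
have D0 := noncollinear_gram cc.1 nl.
have [r01 _ _] := (configurationP q).1 cc.1.
have [r01' _ _] := (configurationP q').1 cc'.1.
have uvE (p : 'M[R]_3) : row 1 p - row 2 p = (row 1 p - row 0 p) - (row 2 p - row 0 p).
  by rewrite opprB addrA subrK.
rewrite -oppr_eq0 opprB -enorm_gt0 in r01; rewrite -oppr_eq0 opprB -enorm_gt0 in r01'.
rewrite !uvE in h12 h12'.
set u := row 1 q - row 0 q in r01 h01 h12 D0.
set v := row 2 q - row 0 q in h02 h12 D0.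
set u' := row 1 q' - row 0 q' in r01' h01' h12'.
set v' := row 2 q' - row 0 q' in h02' h12'.
have [Eu Ev Eu' Ev'] : [/\ row 1 q - row 0 q = u, row 2 q - row 0 q = v,
  row 1 q' - row 0 q' = u' & row 2 q' - row 0 q' = v'] by [].
clearbody u v u' v'.
pose a := enorm u' / enorm u.
have a0 : 0 < a by rewrite divr_gt0.
have ua : enorm u' = a * enorm u by rewrite /a divfK// gt_eqF.
have scale (mm G r r' : R) : 0 < mm ->
    G = lambda * mm * r ^+ 3 -> G = lambda' * mm * r' ^+ 3 ->
    lambda * r ^+ 3 = lambda' * r' ^+ 3.
  move=> mm0 -> E; apply: (mulfI (lt0r_neq0 mm0)).
  by transitivity (lambda * mm * r ^+ 3); [|rewrite E]; ring.
(* For each side, the masses and G fix lambda r^3. The first side therefore gives lambda = lambda'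
   a^3, and the other two sides are stretched by the same a, cubes being injective on nonnegative
   reals. *)
have key (mm G r r' : R) : 0 < mm -> 0 <= r -> 0 <= r' ->
    G = lambda * mm * r ^+ 3 -> G = lambda' * mm * r' ^+ 3 -> r' = a * r.
  move=> mm0 rge rge' G1 G2.
  have L := scale _ _ _ _ mm0 G1 G2.
  have L1 : lambda = lambda' * a ^+ 3.
    apply: (mulIf (_ : enorm u ^+ 3 != 0)); first by rewrite expf_neq0// gt_eqF.
    rewrite -mulrA -exprMn -ua.
    exact: scale (mulr_gt0 (m0 0) (m0 1)) h01 h01'.
  apply/eqP; rewrite -(@eqrXn2 _ 3)//; last by rewrite mulr_ge0// ltW.
  apply/eqP; apply: (mulfI (lt0r_neq0 l0')).
  by rewrite -L L1; ring.
have va : enorm v' = a * enorm v.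
  by apply: key h02 h02'; rewrite ?mulr_gt0 ?enorm_ge0.
have wa : enorm (u' - v') = a * enorm (u - v).
  by apply: key h12 h12'; rewrite ?mulr_gt0 ?enorm_ge0.
have sq w w' : enorm w' = a * enorm w -> dot w' w' = a ^+ 2 * dot w w.
  by rewrite -!enorm_sqr => ->; rewrite exprMn.
have uu := sq _ _ ua; have vv := sq _ _ va.
(* The angle comes from the third side by polarization. *)
have uv : dot u' v' = a ^+ 2 * dot u v.
  have := sq _ _ wa; rewrite !dot_sub uu vv.
  by lra.
have an0 : a != 0 by rewrite gt_eqF.
have [|||A [AA dA uA vA]] := @exists_rotation _ u v (a^-1 *: u') (a^-1 *: v') D0.
- by rewrite dotZl dotZr uu; field.
- by rewrite dotZl dotZr vv; field.
- by rewrite dotZl dotZr uv; field.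
apply: (similar_from_sides a0 AA dA).
- by rewrite Eu Eu' uA scalerA divff// scale1r.
- by rewrite Ev Ev' vA scalerA divff// scale1r.
Qed.

End NonCollinear.

(** * Number of classes *)

Section Count.
Context {R : realType}.
Implicit Types (m : 'I_3 -> R) (g : 'I_3 -> 'I_3 -> R).

Lemma collinear_classes_le3 m g : (forall i, 0 < m i) ->
  exists2 n : nat, (n <= 3)%N &
    (similarity_classes (collinear_critical_point m g) #= `I_n)%card.
Proof.
move=> m0; have [n n3 cn] := atmost_card
  (@atmost3_shapes R _ _ _ (g 0 1) (g 0 2) (g 1 2) (m0 0) (m0 1) (m0 2)).
by exists n => //; exact: card_eq_trans (card_collinear_classes g m0) cn.
Qed.

Lemma card_collinear_classes_eq m g (s : seq R) : (forall i, 0 < m i) ->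
  let S := shapes (m 0) (m 1) (m 2) (g 0 1) (g 0 2) (g 1 2) in
  atmost (size s) S -> uniq s -> (forall x, x \in s -> S x) ->
  (similarity_classes (collinear_critical_point m g) #= `I_(size s))%card.
Proof.
move=> m0 S Sn us sS; have [k kn Sk] := atmost_card Sn.
have -> : size s = k by apply/eqP; rewrite eqn_leq kn (card_geq_uniq Sk us sS).
exact: card_eq_trans (card_collinear_classes g m0) Sk.
Qed.

Lemma zero_collinear_classes :
  exists m g, (forall i, 0 < m i) /\
    (similarity_classes (collinear_critical_point m g) #= `I_0)%card.
Proof.
exists (fun=> 1), (fun _ _ => 0); split => //.
apply: (@card_collinear_classes_eq _ _ [::]) => //.
by apply: (@atmost_shapes _ _ _ _ _ _ _ 0 0 0)%N; exact: atmost_cc_nonpos.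
Qed.

Lemma one_collinear_class :
  exists m g, (forall i, 0 < m i) /\
    (similarity_classes (collinear_critical_point m g) #= `I_1)%card.
Proof.
(* Only bodies 0 and 2 interact, and body 1 rests at their midpoint. The zero coefficients count as
   nonpositive when the other two orders are excluded. *)
exists (fun=> 1), (fun i j => if (i == 0) && (j == 2) then 1 else 0); split => //.
apply: (@card_collinear_classes_eq _ _ [:: 2^-1]) => //=.
  apply: (@atmost_shapes _ _ _ _ _ _ _ 1 0 0)%N.
  - exact: atmost_cc_nonneg.
  - exact: atmost_cc_inner_nonneg.
  - by apply: atmost_cc_rev => //; exact: atmost_cc_inner_nonneg.
move=> x; rewrite inE => /eqP ->; left; left; split; [lra|lra|].
rewrite (_ : (1 - 2^-1) / 2^-1 = 1); last by field.
by exists (1 / 4) => //; split => //; field.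
Qed.

Lemma two_collinear_classes :
  exists m g, (forall i, 0 < m i) /\
    (similarity_classes (collinear_critical_point m g) #= `I_2)%card.
Proof.
(* The values are tuned so that the gap ratio 1 in the order 0, 1, 2 and the gap ratio 2 in the
   order 0, 2, 1 are exact solutions, with multipliers 5 and 3 / 4; they give the shapes 1 / 2 and
   3. *)
exists (fun i => if i == 0 then 1 else if i == 1 then 13 else 61),
  (fun i j => if i == 1 then 61 else if j == 1 then 9 else 0); split.
  by apply: forall3.
apply: (@card_collinear_classes_eq _ _ [:: 2^-1; 3]) => //=.
- by apply: forall3.
- apply: (@atmost_shapes _ _ _ _ _ _ _ 1 1 0)%N => //.
  + exact: atmost_cc_nonneg.
  + exact: atmost_cc_nonneg.
  + apply: atmost_cc_rev => //.
    (* With body 0 in the middle, [g02] = 0 counts as a nonpositive adjacent coefficient, and the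
       necessary inequality of [cc_inner_nonpos] fails. *)
    have gm : (9 * 61 < 61 * 1 :> R) = false by apply/negbTE; rewrite -leNgt; lra.
    by have := @atmost_cc_inner_nonpos R 61 1 13 0 61 9; rewrite gm; apply.
- by rewrite inE andbT; apply/eqP => h; lra.
- move=> x; rewrite !inE => /orP[] /eqP ->.
    left; left; split; [lra|lra|].
    rewrite (_ : (1 - 2^-1) / 2^-1 = 1); last by field.
    by exists 5 => //; split => //; field.
  left; right; split; first by lra.
  rewrite (_ : 3 - 1 = 2); last by ring.
  by exists (3 / 4) => //; split => //; field.
Qed.

Lemma three_collinear_classes :
  exists m g, (forall i, 0 < m i) /\
    (similarity_classes (collinear_critical_point m g) #= `I_3)%card.
Proof.
(* Equal masses under attraction: by symmetry each body can be placed halfway between the other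
   two. *)
exists (fun=> 1), (fun _ _ => 1); split => //.
apply: (@card_collinear_classes_eq _ _ [:: 2^-1; 2; -1]) => //=.
- exact: atmost3_shapes.
- by rewrite !inE !andbT negb_or -andbA; apply/and3P; split; apply/eqP => h; lra.
- have sol : @ordered_cc R 1 1 1 1 1 1 1 by exists (5 / 4) => //; split => //; field.
  move=> x; rewrite !inE => /or3P[] /eqP ->.
  + left; left; split; [lra|lra|].
    by rewrite (_ : (1 - 2^-1) / 2^-1 = 1) //; field.
  + left; right; split; first by lra.
    by rewrite (_ : 2 - 1 = 1) //; field.
  + right; split; first by lra.
    by rewrite invrN1 opprK.
Qed.

Lemma noncollinear_classes_le1 m g : (forall i, 0 < m i) ->
  (similarity_classes (noncollinear_critical_point m g) #<= `I_1)%card.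
Proof.
move=> m0.
have sim z w : noncollinear_critical_point m g z -> noncollinear_critical_point m g w ->
    Defs.similar z.1 w.1.
  move=> [[_ _ _ [l [_ [l0 ccz _ _ _]]]] nz] [[_ _ _ [l' [_ [l0' ccw _ _ _]]]] nw].
  exact: noncollinear_similar l0 l0' ccz nz ccw nw.
(* Any two of these critical points are similar, so a constant is a complete invariant. *)
have := @card_similarity_classes R (noncollinear_critical_point m g) unit (fun=> tt)
  (fun z w Sz Sw => conj (fun=> erefl) (fun=> sim z w Sz Sw)).
move=> /card_le_eql ->; rewrite -(card_le_eqr (card_set1 (x := tt))).
by apply: subset_card_le => -[].
Qed.

End Count.

Theorem theorem1p3 (R : realType) :
  [/\ forall (m : 'I_3 -> R) (g : 'I_3 -> 'I_3 -> R), (forall i, 0 < m i) ->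
        exists2 n : nat, (n <= 3)%N &
          (similarity_classes (collinear_critical_point m g) #= `I_n)%card,
      forall n : nat, (n <= 3)%N ->
        exists (m : 'I_3 -> R) (g : 'I_3 -> 'I_3 -> R), (forall i, 0 < m i) /\
          (similarity_classes (collinear_critical_point m g) #= `I_n)%card
    & forall (m : 'I_3 -> R) (g : 'I_3 -> 'I_3 -> R), (forall i, 0 < m i) ->
        (similarity_classes (noncollinear_critical_point m g) #<= `I_1)%card].
Proof.
split=> [m g m0|[|[|[|[|//]]]] _|m g m0].
- exact: collinear_classes_le3.
- exact: zero_collinear_classes.
- exact: one_collinear_class.
- exact: two_collinear_classes.
- exact: three_collinear_classes.
- exact: noncollinear_classes_le1.
Qed.
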